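(* Let $X$ be a separable Banach space and let $Y$ be a subspace of $X^*$ such that $H_Y(X)$ is of infinite codimension in $Y^*$. Then: (A) There exists an isomorphic embedding $T:Y\to X^*$ whose image is total and, moreover, satisfies $(T(Y))_{(2)}=X^*$. (B) If additionally the subspace $Y^\top\subset X$ is infinite-dimensional, then the operator $T$ can be chosen in such a way that $(T(Y))_{(1)}\neq (T(Y))_{(2)}=X^*$. (C) If additionally the subspace $Y^\top\subset X$ is nonquasireflexive, then for every countable ordinal $\alpha$ there exists an isomorphic embedding $T:Y\to X^*$ such that $(T(Y))_{(\alpha)}\neq (T(Y))_{(\alpha+1)}=X^*$.
   Context: For a subspace $Y\subset X^*$, the map $H_Y:X\to Y^*$ is the natural one: $(H_Y x)(y)=y(x)$ for $x\in X$, $y\in Y$. Also $Y^\top=\{x\in X: y(x)=0 \text{ for all } y\in Y\}$. A Banach space $Z$ is quasireflexive if its canonical image in $Z^{**}$ has finite codimension (reflexive spaces included), and nonquasireflexive otherwise. A subspace $M\subset X^*$ is total if for every $0\ne x\in X$ there is $f\in M$ with $f(x)\ne0$. An isomorphic embedding is a bounded linear operator that is an isomorphism (linear homeomorphism) onto its image. Weak$^*$ sequential closures: for a subspace $M\subset X^*$, $M_{(1)}$ is the set of all limits of weak$^*$ convergent sequences from $M$. With $M_{(0)}=M$, the weak$^*$ sequential closure of order $\alpha$, for an ordinal $\alpha\ge 1$, is defined by transfinite recursion as $M_{(\alpha)}=\bigcup_{\beta<\alpha}(M_{(\beta)})_{(1)}$.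
   Formalization: In (C) the countable ordinal α is taken to be at least 1; for α = 0 the claim fails, e.g. X = l_1 ⊕ Z, Y = Z*, with Z the l_2-sum of infinitely many copies of James' space. *)

(* Defs.v *)
From HB Require Import structures.
From mathcomp Require Import all_boot all_order all_algebra.
From mathcomp Require Import complex.
From mathcomp Require Import all_classical all_reals all_analysis.

Set Implicit Arguments.
Unset Strict Implicit.
Unset Printing Implicit Defensive.

Import Order.TTheory GRing.Theory Num.Theory.
Import numFieldNormedType.Exports.

Local Open Scope classical_set_scope.
Local Open Scope ring_scope.

Variant scalar_kind := RealScalars | ComplexScalars.

Definition scalars (R : realType) (k : scalar_kind) : numFieldType :=
  match k with RealScalars => R | ComplexScalars => R[i] end.

(* The norm of a normed module over [K] takes its values in [K], hence so does
   the dual norm; over [R[i]] the order is partial, but a nonempty set of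
   nonnegative (hence real) elements with an upper bound has a supremum. *)
Lemma scalars_supremums (R : realType) (k : scalar_kind)
    (A : set (scalars R k)) :
  (forall a, A a -> 0 <= a) -> A !=set0 -> has_ubound A ->
  supremums A !=set0.
Proof.
case: k A => /= A A0 Ane Aub.
  have [l lP] : has_sup A by split.
  exists (sup A); split; first by apply: sup_upper_bound; split.
  by move=> u uA; apply: ge_sup.
have sA : has_sup [set complex.Re a | a in A].
  split; first by case: Ane => a Aa; exists (complex.Re a), a.
  case: Aub => u uA; exists (complex.Re u) => _ [a Aa <-].
  by have := uA _ Aa; rewrite lecE => /andP[].
have ImA a : A a -> complex.Im a = 0.
  by move=> /A0; rewrite lecE => /andP[/eqP ->].
exists (sup [set complex.Re a | a in A])%:C%C; split.
  move=> a Aa; rewrite lecE /= (ImA _ Aa) eqxx /=.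
  by apply: sup_upper_bound => //; exists a.
move=> u uA; rewrite lecE /=; apply/andP; split.
  case: Ane => a Aa; have := uA _ Aa.
  by rewrite lecE (ImA _ Aa) => /andP[].
apply: ge_sup; first by case: sA.
by move=> _ [a Aa <-]; have := uA _ Aa; rewrite lecE => /andP[].
Qed.

(* [Y : submodClosed E] is an arbitrary (not necessarily closed) linear
   subspace of [E]. *)
Definition subspace_type (K : numFieldType) (E : normedModType K)
  (Y : submodClosed E) : Type := {x : E | x \in Y}.

Section SubspaceType.
Context (K : numFieldType) (E : normedModType K) (Y : submodClosed E).

HB.instance Definition _ := SubType.on (subspace_type Y).
HB.instance Definition _ := [Choice of subspace_type Y by <:].
HB.instance Definition _ := [SubChoice_isSubLmodule of subspace_type Y by <:].

Let subnorm (y : subspace_type Y) : K := `|val y|.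

Let subnormD (x y : subspace_type Y) : subnorm (x + y) <= subnorm x + subnorm y.
Proof. by rewrite /subnorm raddfD ler_normD. Qed.

Let subnormZ (a : K) (y : subspace_type Y) : subnorm (a *: y) = `|a| * subnorm y.
Proof. by rewrite /subnorm linearZ normrZ. Qed.

Let subnorm0 (y : subspace_type Y) : subnorm y = 0 -> y = 0.
Proof. by move=> /normr0_eq0 y0; apply: val_inj; rewrite raddf0. Qed.

HB.instance Definition _ :=
  Lmodule_isNormed.Build K (subspace_type Y) subnormD subnormZ subnorm0.

Lemma subspace_normE (y : subspace_type Y) : `|y| = `|val y|.
Proof. by []. Qed.

End SubspaceType.

Section Dual.
Context (R : realType) (k : scalar_kind).
Local Notation K := (scalars R k).
Context (E : normedModType K).

Definition continuous_functional : {pred E -> K^o} :=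
  mem [set f : E -> K^o | scalar f /\ continuous f].

Lemma continuous_functional_submod : submod_closed continuous_functional.
Proof.
split.
  rewrite inE; split=> [a x y|x]; last exact: cvg_cst.
  by rewrite /= mulr0 addr0.
move=> a f g; rewrite !inE => -[fl fc] [gl gc]; split.
  move=> b x y; rewrite !fctE fl gl /GRing.scale /=.
  by rewrite !mulrDr addrACA (mulrCA a b).
by move=> x; apply: (@continuousD K K^o E (a *: f) g);
  [apply: (@continuousZl_tmp K K^o E f a); exact: fc|exact: gc].
Qed.

HB.instance Definition _ := GRing.isSubmodClosed.Build K (E -> K^o)
  continuous_functional continuous_functional_submod.

Definition dual : Type := {f : E -> K^o | f \in continuous_functional}.

HB.instance Definition _ := SubType.on dual.
HB.instance Definition _ := [Choice of dual by <:].
HB.instance Definition _ := [SubChoice_isSubLmodule of dual by <:].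

Definition dual_fun (f : dual) : E -> K^o := val f.
Coercion dual_fun : dual >-> Funclass.

Lemma dual_scalar (f : dual) : scalar f.
Proof. by have := valP f; rewrite inE => -[]. Qed.

HB.instance Definition _ (f : dual) :=
  GRing.isLinear.Build K E K^o *%R (dual_fun f) (dual_scalar f).

Lemma dual_continuous (f : dual) : continuous f.
Proof. by have := valP f; rewrite inE => -[]. Qed.

Lemma dualP (f g : dual) : f =1 g -> f = g.
Proof. by move=> fg; apply/val_inj/funext. Qed.

Lemma dual_addE (f g : dual) (x : E) : (f + g : dual) x = f x + g x.
Proof. by []. Qed.

Lemma dual_scaleE (a : K) (f : dual) (x : E) : (a *: f : dual) x = a * f x.
Proof. by []. Qed.

Definition dual_norm (f : dual) : K :=
  supremum 0 [set `|f x| | x in [set x : E | `|x| <= 1]].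

Lemma dual_norm_supremums (f : dual) :
  supremums [set `|f x| | x in [set x : E | `|x| <= 1]] !=set0.
Proof.
apply: scalars_supremums.
- by move=> _ [x _ <-].
- by exists `|f 0|, 0 => //=; rewrite normr0.
have /linear_boundedP : bounded_near f (nbhs 0).
  by apply/linear_bounded_continuous; exact: dual_continuous.
move=> /pinfty_ex_gt0[r r0 fr]; exists r => _ [x /= x1 <-].
by rewrite (le_trans (fr x))// ler_piMr// ltW.
Qed.

Lemma dual_norm_lub (f : dual) :
  supremums [set `|f x| | x in [set x : E | `|x| <= 1]] (dual_norm f).
Proof.
have [l lf] := dual_norm_supremums f.
rewrite /dual_norm /supremum; case: ifPn => [/eqP f0|_].
  have : [set `|f x| | x in [set x : E | `|x| <= 1]] `|f 0|.
    by exists 0 => //=; rewrite normr0.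
  by rewrite f0.
by case: xgetP => [y yA //|/(_ l)].
Qed.

Lemma dual_norm_ub (f : dual) x : `|x| <= 1 -> `|f x| <= dual_norm f.
Proof. by move=> x1; apply: (dual_norm_lub f).1; exists x. Qed.

Lemma dual_norm_le (f : dual) (c : K) :
  (forall x, `|x| <= 1 -> `|f x| <= c) -> dual_norm f <= c.
Proof. by move=> fc; apply: (dual_norm_lub f).2 => _ [x x1 <-]; exact: fc. Qed.

Lemma dual_norm_ge0 (f : dual) : 0 <= dual_norm f.
Proof. by apply: (le_trans (normr_ge0 (f 0))); rewrite dual_norm_ub ?normr0. Qed.

Lemma dual_norm_bound (f : dual) (x : E) : `|f x| <= dual_norm f * `|x|.
Proof.
have [->|x0] := eqVneq x 0; first by rewrite linear0 !normr0 mulr0.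
rewrite -ler_pdivrMr ?normr_gt0//.
have := @dual_norm_ub f (`|x|^-1 *: x).
rewrite normfZV// lexx linearZ /= normrM normfV normr_id mulrC.
exact.
Qed.

Let dual_normD (f g : dual) : dual_norm (f + g) <= dual_norm f + dual_norm g.
Proof.
apply: dual_norm_le => x x1; apply: (le_trans (ler_normD (f x) (g x))).
by rewrite lerD ?dual_norm_ub.
Qed.

Let dual_normZ_le (a : K) (f : dual) : dual_norm (a *: f) <= `|a| * dual_norm f.
Proof.
apply: dual_norm_le => x x1.
have -> : (a *: f : dual) x = a * f x by [].
by rewrite normrM ler_wpM2l ?dual_norm_ub.
Qed.

Let dual_normZ (a : K) (f : dual) : dual_norm (a *: f) = `|a| * dual_norm f.
Proof.
have [->|a0] := eqVneq a 0.
  apply/eqP; rewrite normr0 mul0r eq_le dual_norm_ge0 andbT.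
  by have := dual_normZ_le 0 f; rewrite normr0 mul0r.
apply/eqP; rewrite eq_le dual_normZ_le/= -ler_pdivlMl ?normr_gt0//.
have := dual_normZ_le a^-1 (a *: f).
by rewrite scalerA mulVf// scale1r normfV.
Qed.

Let dual_norm0 (f : dual) : dual_norm f = 0 -> f = 0.
Proof.
move=> f0; apply: dualP => x; apply/normr0_eq0/eqP.
by rewrite eq_le normr_ge0 andbT (le_trans (dual_norm_bound f x))// f0 mul0r.
Qed.

HB.instance Definition _ :=
  Lmodule_isNormed.Build K dual dual_normD dual_normZ dual_norm0.

Lemma dual_normE (f : dual) : `|f| = dual_norm f.
Proof. by []. Qed.

End Dual.

Arguments dual {R k} E.

Lemma functionalP (R : realType) (k : scalar_kind)
    (E : normedModType (scalars R k)) (f : E -> (scalars R k)^o) (c : scalars R k) :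
  scalar f -> 0 <= c -> (forall x, `|f x| <= c * `|x|) ->
  f \in @continuous_functional R k E.
Proof.
move=> fl c0 fc; rewrite inE; split => //.
pose fL := GRing.isLinear.Build _ E (scalars R k)^o *%R f fl.
pose F : {scalar E} := HB.pack f fL.
apply: (@bounded_linear_continuous _ E (scalars R k)^o F).
apply/linear_boundedP; near=> r => x.
rewrite (le_trans (fc x))// ler_wpM2r//.
by near: r; apply: nbhs_pinfty_ge; rewrite ger0_real.
Unshelve. all: by end_near. Qed.

Section Evaluation.
Context (R : realType) (k : scalar_kind) (E : normedModType (scalars R k)).
Local Notation K := (scalars R k).

Lemma Hmap_functional (Y : submodClosed (dual E)) (x : E) :
  (fun y : subspace_type Y => (val y : dual E) x : K^o)
    \in @continuous_functional R k (subspace_type Y).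
Proof.
apply: (@functionalP _ _ _ _ `|x|).
- by move=> a y z; rewrite linearP dual_addE dual_scaleE.
- exact: normr_ge0.
- by move=> y; rewrite mulrC; exact: (dual_norm_bound (val y)).
Qed.

Definition Hmap (Y : submodClosed (dual E)) (x : E) : dual (subspace_type Y) :=
  Sub (fun y : subspace_type Y => (val y : dual E) x : K^o) (Hmap_functional Y x).

Lemma HmapE (Y : submodClosed (dual E)) (x : E) (y : subspace_type Y) :
  Hmap Y x y = (val y : dual E) x.
Proof. by []. Qed.

Lemma bidual_functional (x : E) :
  (fun f : dual E => f x : K^o) \in @continuous_functional R k (dual E).
Proof.
apply: (@functionalP _ _ _ _ `|x|).
- by move=> a f g; rewrite dual_addE dual_scaleE.
- exact: normr_ge0.
- by move=> f; rewrite mulrC; exact: (dual_norm_bound f).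
Qed.

Definition bidual_embedding (x : E) : dual (dual E) :=
  Sub (fun f : dual E => f x : K^o) (bidual_functional x).

Lemma bidual_embeddingE (x : E) (f : dual E) : bidual_embedding x f = f x.
Proof. by []. Qed.

End Evaluation.

Section PreAnnihilator.
Context (R : realType) (k : scalar_kind) (X : normedModType (scalars R k)).
Context (Y : submodClosed (dual X)).

Definition preannihilator : {pred X} :=
  mem [set x : X | forall y : dual X, y \in Y -> y x = 0].

Lemma preannihilator_submod : submod_closed preannihilator.
Proof.
split=> [|a u v]; rewrite !inE; first by move=> y _; rewrite linear0.
by move=> u0 v0 y yY; rewrite linearP /= u0// v0// mulr0 addr0.
Qed.

HB.instance Definition _ := GRing.isSubmodClosed.Build (scalars R k) X
  preannihilator preannihilator_submod.

End PreAnnihilator.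

Definition finite_dim (K : numFieldType) (V : lmodType K) : Prop :=
  exists (n : nat) (b : 'I_n -> V),
    forall v, exists c : 'I_n -> K, v = \sum_(i < n) c i *: b i.

(* Meant for [S] a linear subspace of [V]. *)
Definition finite_codim (K : numFieldType) (V : lmodType K) (S : set V) : Prop :=
  exists (n : nat) (b : 'I_n -> V),
    forall v, exists (s : V) (c : 'I_n -> K),
      S s /\ v = s + \sum_(i < n) c i *: b i.

Definition quasireflexive (R : realType) (k : scalar_kind)
    (Z : normedModType (scalars R k)) : Prop :=
  finite_codim (range (@bidual_embedding R k Z)).

Definition isomorphic_embedding (K : numFieldType) (V W : normedModType K)
    (T : {linear V -> W}) : Prop :=
  continuous T /\
  exists g : W -> V, cancel T g /\ {within range T, continuous g}.

Definition total_set (R : realType) (k : scalar_kind)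
    (X : normedModType (scalars R k)) (M : set (dual X)) : Prop :=
  forall x : X, x != 0 -> exists2 f, M f & f x != 0.

Definition separable_space (T : topologicalType) : Prop :=
  exists2 D : set T, countable D & dense D.

Record wellOrder := WellOrder {
  wo_sort :> Type;
  wo_lt : wo_sort -> wo_sort -> Prop;
  wo_wf : well_founded wo_lt;
  wo_trans : forall u v w, wo_lt u v -> wo_lt v w -> wo_lt u w;
  wo_total : forall u v, [\/ wo_lt u v, u = v | wo_lt v u]
}.

Section FiniteOrdinal.
Context (n : nat).

Definition wo_fin_lt (i j : 'I_n) : Prop := (i < j)%N.

Lemma wo_fin_wf : well_founded wo_fin_lt.
Proof.
suff acc m (i : 'I_n) : (i < m)%N -> Acc wo_fin_lt i.
  by move=> i; exact: (acc i.+1 i (ltnSn i)).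
elim: m i => [i|m IHm i im]; first by rewrite ltn0.
constructor => j ji; apply: IHm; move: ji; rewrite /wo_fin_lt => ji.
by rewrite (leq_trans ji).
Qed.

Lemma wo_fin_trans (u v w : 'I_n) :
  wo_fin_lt u v -> wo_fin_lt v w -> wo_fin_lt u w.
Proof. exact: ltn_trans. Qed.

Lemma wo_fin_total (u v : 'I_n) : [\/ wo_fin_lt u v, u = v | wo_fin_lt v u].
Proof.
by have [uv|vu|/val_inj uv] := ltngtP u v; [exact: Or31|exact: Or33|exact: Or32].
Qed.

Definition wo_fin : wellOrder := WellOrder wo_fin_wf wo_fin_trans wo_fin_total.

End FiniteOrdinal.

(* [None] is a new greatest element. *)
Section SuccOrdinal.
Context (A : wellOrder).

Definition wo_succ_lt (u v : option A) : Prop :=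
  match u, v with
  | Some a, Some b => wo_lt a b
  | Some _, None => True
  | None, _ => False
  end.

Lemma wo_succ_wf : well_founded wo_succ_lt.
Proof.
have accS a : Acc wo_succ_lt (Some a).
  by elim/(well_founded_ind (@wo_wf A)): a => a IHa; constructor => -[b /IHa|].
by case=> [a|]; [exact: accS|constructor => -[b|] // _; exact: accS].
Qed.

Lemma wo_succ_trans (u v w : option A) :
  wo_succ_lt u v -> wo_succ_lt v w -> wo_succ_lt u w.
Proof. by case: u v w => [a|] [b|] [c|] //=; exact: wo_trans. Qed.

Lemma wo_succ_total (u v : option A) :
  [\/ wo_succ_lt u v, u = v | wo_succ_lt v u].
Proof.
case: u v => [a|] [b|] /=; last exact: Or32; [|exact: Or31|exact: Or33].
by have [ab|->|ba] := wo_total a b; [exact: Or31|exact: Or32|exact: Or33].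
Qed.

Definition wo_succ : wellOrder :=
  WellOrder wo_succ_wf wo_succ_trans wo_succ_total.

End SuccOrdinal.

Section WeakStarClosure.
Context (R : realType) (k : scalar_kind) (X : normedModType (scalars R k)).
Implicit Types (M : set (dual X)) (f : dual X) (A : wellOrder).

Definition weak_star_cvg (u : nat -> dual X) f : Prop :=
  forall x : X, u n x @[n --> \oo] --> f x.

Definition weak_star_limits M : set (dual X) :=
  [set f | exists u : nat -> dual X, (forall n, M (u n)) /\ weak_star_cvg u f].

(* For [w : A], the closure of [M] whose order is the ordinal of
   [{v | wo_lt v w}]. *)
Definition closure_below A M : A -> set (dual X) :=
  Fix (@wo_wf A) (fun=> set (dual X)) (fun w closure_at =>
    [set f | ((forall v, ~ wo_lt v w) /\ M f) \/
             exists (v : A) (vw : wo_lt v w),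
               weak_star_limits (closure_at v vw) f]).

(* [M_(alpha)] for [alpha] the order type of [A]. *)
Definition weak_star_closure M A : set (dual X) :=
  [set f | ((A -> False) /\ M f) \/
           exists v : A, weak_star_limits (closure_below M v) f].

Lemma closure_belowE A M (w : A) :
  closure_below M w =
  [set f | ((forall v, ~ wo_lt v w) /\ M f) \/
           exists2 v : A, wo_lt v w & weak_star_limits (closure_below M v) f].
Proof.
rewrite {1}/closure_below Fix_eq => [|u F G FG].
  apply/seteqP; split => f [Mf|]; try by left.
    by move=> [v [vw vf]]; right; exists v.
  by move=> [v vw vf]; right; exists v, vw.
suff -> : F = G by [].
by apply: functional_extensionality_dep => v; apply: functional_extensionality_dep.
Qed.

Lemma weak_star_closure0 M : weak_star_closure M (wo_fin 0) = M.
Proof.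
apply/seteqP; split => f; first by case=> [[]//|[[]]].
by move=> Mf; left; split => // -[].
Qed.

Lemma closure_below_succ M A (v : A) :
  closure_below (A := wo_succ A) M (Some v) = closure_below M v.
Proof.
elim/(well_founded_ind (@wo_wf A)): v => v IH; rewrite !closure_belowE.
apply/seteqP; split=> f [[h Mf]|].
- by left; split => // u; exact: (h (Some u)).
- by move=> [[u|] //= uv]; rewrite IH //; right; exists u.
- by left; split => // -[u /= /h|].
- by move=> [u uv]; rewrite -IH //; right; exists (Some u).
Qed.

Lemma closure_below_top M A :
  closure_below (A := wo_succ A) M None = weak_star_closure M A.
Proof.
rewrite closure_belowE; apply/seteqP; split=> f [[h Mf]|].
- by left; split => // u; exact: (h (Some u)).
- by move=> [[u|] //= _]; rewrite closure_below_succ; right; exists u.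
- by left; split => // -[u|] //=.
- by move=> [u uf]; right; exists (Some u) => //; rewrite closure_below_succ.
Qed.

Lemma weak_star_closure_succ M A : weak_star_closure M (wo_succ A) =
  weak_star_limits (weak_star_closure M A) `|`
  [set f | exists v : A, weak_star_limits (closure_below M v) f].
Proof.
apply/seteqP; split=> f.
- move=> [[/(_ None)//]|[[v|]]]; first by rewrite closure_below_succ; right; exists v.
  by rewrite closure_below_top; left.
- case=> [h|[v h]]; right; first by exists None; rewrite closure_below_top.
  by exists (Some v); rewrite closure_below_succ.
Qed.

Lemma weak_star_closure1 M : weak_star_closure M (wo_fin 1) = weak_star_limits M.
Proof.
have E (v : 'I_1) : closure_below (A := wo_fin 1) M v = M.
  have h (u w : wo_fin 1) : ~ wo_lt u w by rewrite (ord1 u) (ord1 w).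
  rewrite closure_belowE; apply/seteqP; split=> f; last by left; split.
  by case=> [[]//|[u /h]].
apply/seteqP; split=> f; first by case=> [[/(_ ord0)]//|[v]]; rewrite E.
by move=> Mf; right; exists ord0; rewrite E.
Qed.

End WeakStarClosure.

(* Main.v *)
Require Import Defs.
From HB Require Import structures.
From mathcomp Require Import all_boot all_order all_algebra.
From mathcomp Require Import all_classical all_reals all_analysis.
From mathcomp Require Import complex ring lra.

(* The embeddings are perturbations [T y = y + \sum_i y_i(y) (b_i g_i - f_i o H_Y)]
   of the inclusion of [Y], where [y_i] in [Y^*] and [f_i] in [Y^**] are
   biorthogonal and the functionals [f_i o H_Y] on [X] are small; such systems
   exist because otherwise the open mapping argument would make [H_Y] onto up to a
   finite-dimensional space. The second adjoint of [T] maps [f_i] to [b_i g_i], so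
   the first closure of [T(Y)] contains all the [g_i], while on [Y^T] it consists
   of rapidly converging series in the [g_i].

   Taking the [g_i] weak* dense in the ball of [X^*] gives (A). Unit vectors of
   [Y^T] in the common kernel of more and more [g_i] show that the first closure
   is not [X^*] when [Y^T] is infinite-dimensional, hence (B).

   For (C) the [g_i] are weak* dense in the unit ball of a subspace [L] of [X^*]
   given by relations on [Y^T]. Nonquasireflexivity provides bounded sequences
   ("rows") [s_p] in [Y^T] with separated increments
   [x_(q, m) = s_(q, m) - s_(q, m - 1)], indexed by the nodes [p] of a
   well-founded tree of rank [alpha], and [L] is defined by
   [lim_l f(s_(p, l)) = 2^m f(x_(q, m))] for every node [p = m :: q], the limit
   being [0] at the root. The relation at [q] survives a passage to the limit as
   long as those at almost all its children hold, so it is lost after a number of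
   closures given by the rank of [q], and the relation at the root survives
   exactly [alpha] closures. *)

Set Implicit Arguments.
Unset Strict Implicit.
Unset Printing Implicit Defensive.

Import Order.TTheory GRing.Theory Num.Theory.
Import numFieldNormedType.Exports.

Local Open Scope classical_set_scope.
Local Open Scope ring_scope.

(** * Real-valued norms *)

(** Write [M] for the range of [T] in case (C). On [Y^T] the functionals [f_i o H_Y] vanish, so
    [T y] is there the series of the [y_i(y) b_i g_i]. As [T] is bounded below, its tail estimate is
    uniform along a weak* convergent sequence, which puts [M_(1)] inside [L]; conversely [L_(1)]
    lies in [M_(2)]. So the closures of [M] follow those of [L] with one step of delay. The obstacle
    is to lose a relation at a prescribed step. An equation [f(x) = 0] with [x] in [X] survives
    every closure, so limits along bounded sequences imitating elements of [Z^**] outside [Z = Y^T]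
    are used instead. The factor [2^m] makes the increments of a bounded functional along row [q]
    summable while the relations at the children of [q] hold. Conversely a functional that jumps
    from [0] to [1] at index [m] of row [q] changes the limit along that row and disturbs, besides,
    only the target of [m :: q]. The rows must be independent for such functionals to exist, and
    infinitely many are needed: this is where [Z] has to be nonquasireflexive. *)

Section ScalarEmbedding.
Context {R : realType} {k : scalar_kind}.
Local Notation K := (scalars R k).

Definition toK : R -> K :=
  match k return R -> scalars R k with
  | RealScalars => id
  | ComplexScalars => fun r => r%:C%C
  end.

Definition toR : K -> R :=
  match k return scalars R k -> R with
  | RealScalars => id
  | ComplexScalars => @complex.Re R
  end.

Lemma toKD r s : toK (r + s) = toK r + toK s.
Proof. by rewrite /toK; case: k => //=; rewrite rmorphD. Qed.

Lemma toKM r s : toK (r * s) = toK r * toK s.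
Proof. by rewrite /toK; case: k => //=; rewrite rmorphM. Qed.

Lemma toK1 : toK 1 = 1.
Proof. by rewrite /toK; case: k => //=; rewrite rmorph1. Qed.

Lemma toK0 : toK 0 = 0.
Proof. by rewrite /toK; case: k => //=; rewrite rmorph0. Qed.

Lemma toKN r : toK (- r) = - toK r.
Proof. by apply/eqP; rewrite -subr_eq0 opprK -toKD addNr toK0. Qed.

Lemma toK_le r s : (toK r <= toK s) = (r <= s).
Proof. by rewrite /toK; case: k => //=; rewrite lecR. Qed.

Lemma toK_lt r s : (toK r < toK s) = (r < s).
Proof. by rewrite /toK; case: k => //=; rewrite ltcR. Qed.

Lemma toRK r : toR (toK r) = r.
Proof. by rewrite /toR /toK; case: k. Qed.

Lemma toKI : injective toK.
Proof. by move=> r s rs; rewrite -(toRK r) rs toRK. Qed.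

Lemma toR_ge0K a : 0 <= a -> toK (toR a) = a.
Proof.
by rewrite /toR /toK; case: k a => //= a a0; rewrite RRe_real// ger0_real.
Qed.

(* Norms over [K] take their values in [K]; [rn] is the norm read in [R]. *)
Definition rn {E : normedModType K} (x : E) : R := toR `|x|.

Lemma rnE (E : normedModType K) (x : E) : `|x| = toK (rn x).
Proof. by rewrite /rn toR_ge0K. Qed.

Lemma rn_ge0 (E : normedModType K) (x : E) : 0 <= rn x.
Proof. by rewrite -toK_le toK0 -rnE. Qed.

Lemma rnD (E : normedModType K) (x y : E) : rn (x + y) <= rn x + rn y.
Proof. by rewrite -toK_le toKD -!rnE ler_normD. Qed.

Lemma rnZ (E : normedModType K) (a : K) (x : E) :
  rn (a *: x) = rn (a : K^o) * rn x.
Proof.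
apply: toKI; rewrite toKM -rnE normrZ -(rnE x); congr (_ * _).
exact: (@rnE K^o a).
Qed.

Lemma rn_eq0 (E : normedModType K) (x : E) : (rn x == 0) = (x == 0).
Proof. by rewrite -[x == 0]normr_eq0 rnE -[X in _ = (_ == X)]toK0 (inj_eq toKI). Qed.

Lemma rn0 (E : normedModType K) : rn (0 : E) = 0.
Proof. by apply/eqP; rewrite rn_eq0. Qed.

Lemma rn_gt0 (E : normedModType K) (x : E) : (0 < rn x) = (x != 0).
Proof. by rewrite lt_def rn_ge0 andbT rn_eq0. Qed.

Lemma rnN (E : normedModType K) (x : E) : rn (- x) = rn x.
Proof. by rewrite /rn normrN. Qed.

Lemma rnB (E : normedModType K) (x y : E) : rn (x - y) = rn (y - x).
Proof. by rewrite -rnN opprB. Qed.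

Lemma rn_le_sub (E : normedModType K) (y x : E) : rn x <= rn y + rn (x - y).
Proof. by apply: le_trans (rnD _ _); rewrite addrC subrK. Qed.

Lemma rn_sub_trans (E : normedModType K) (y x z : E) :
  rn (x - z) <= rn (x - y) + rn (y - z).
Proof. by apply: le_trans (rnD _ _); rewrite addrA subrK. Qed.

Lemma rnM (a b : K^o) : rn (a * b : K^o) = rn a * rn b.
Proof. exact: (@rnZ K^o a b). Qed.

Lemma rn_toK r : rn (toK r : K^o) = `|r|.
Proof.
rewrite /rn /toR /toK; case: k => //=.
by rewrite -[LHS]/(complex.Re `|(r%:C%C : R[i])|) normc_def /= expr0n addr0 sqrtr_sqr.
Qed.

Lemma rn_toK_ge0 r : 0 <= r -> rn (toK r : K^o) = r.
Proof. by move=> r0; rewrite rn_toK ger0_norm. Qed.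

Lemma rn1 : rn (1 : K^o) = 1.
Proof. by rewrite -toK1 rn_toK normr1. Qed.

Lemma rnV (a : K^o) : rn (a^-1 : K^o) = (rn a)^-1.
Proof.
have [->|a0] := eqVneq a 0; first by rewrite invr0 rn0 invr0.
have ra0 : rn a != 0 by rewrite rn_eq0.
by apply: (mulfI ra0); rewrite -rnM !divff// rn1.
Qed.

Lemma rn_sum (E : normedModType K) (I : Type) (r : seq I) (P : pred I) (F : I -> E) :
  rn (\sum_(i <- r | P i) F i) <= \sum_(i <- r | P i) rn (F i).
Proof.
elim/big_rec2: _ => [|i y1 y2 _ h]; first by rewrite rn0.
by apply: (le_trans (rnD _ _)); rewrite lerD2l.
Qed.

Lemma rn_phase (a : K^o) : exists2 u : K^o, rn u = 1 & u * a = toK (rn a).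
Proof.
have [->|a0] := eqVneq a 0.
  by exists 1; rewrite ?rn1// mulr0 rn0 toK0.
exists (toK (rn a) * a^-1); last by rewrite -mulrA mulVf// mulr1.
by rewrite rnM rnV rn_toK_ge0 ?rn_ge0// divff// rn_eq0.
Qed.

End ScalarEmbedding.

(** * The Hahn-Banach theorem *)

Section HahnBanachReal.
Context {R : realType} {k : scalar_kind}.
Local Notation K := (scalars R k).
Context (V : lmodType K) (p : V -> R).
Hypothesis pD : forall u v, p (u + v) <= p u + p v.
Hypothesis pZ : forall a v, p (a *: v) = rn (a : K^o) * p v.

Let p0 : p 0 = 0.
Proof. by have := pZ 0 0; rewrite scale0r rn0 mul0r. Qed.

Let pN v : p (- v) = p v.
Proof. by rewrite -scaleN1r pZ rnN rn1 mul1r. Qed.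

Let pR r v : p (toK r *: v) = `|r| * p v.
Proof. by rewrite pZ rn_toK. Qed.

Let p_ge0 v : 0 <= p v.
Proof.
have := pD v (- v); rewrite subrr p0 pN => h; lra.
Qed.

Let real_linear (G : set (V * R)) := forall r u a v b,
  G (u, a) -> G (v, b) -> G (toK r *: u + v, r * a + b).

Let dominated (G : set (V * R)) := forall v a, G (v, a) -> a <= p v.

(** A partial real-linear functional is its graph [G], so that extension is inclusion and Zorn's
    lemma applies to sets directly. The value at [z] must lie between all [a - p(u - z)] and all
    [p(v + z) - b]; subadditivity makes this interval nonempty, and its lower end is taken. *)
Let extend_one (G : set (V * R)) (z : V) :
  G (0, 0) -> real_linear G -> dominated G ->
  exists G', [/\ G `<=` G', exists c, G' (z, c), real_linear G' & dominated G'].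
Proof.
move=> G0 Gl Gp.
have GN v a : G (v, a) -> G (- v, - a).
  by move=> va; have := Gl (-1) _ _ _ _ va G0; rewrite toKN toK1 scaleN1r mulN1r !addr0.
have GZ r v a : G (v, a) -> G (toK r *: v, r * a).
  by move=> va; have := Gl r _ _ _ _ va G0; rewrite !addr0.
pose S := [set va.2 - p (va.1 - z) | va in G].
have Sub v b : G (v, b) -> ubound S (p (v + z) - b).
  move=> vb _ [[u a] /= ua <-].
  have := Gl 1 _ _ _ _ ua vb; rewrite toK1 scale1r mul1r => /Gp.
  have := pD (u - z) (v + z).
  rewrite [v + z]addrC addrA subrK => h1 h2; lra.
have Ssup : has_sup S.
  by split; [exists (0 - p (0 - z)), (0, 0)|exists (p (0 + z) - 0); exact: Sub].
pose c := sup S.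
have c1 u a : G (u, a) -> a - c <= p (u - z).
  move=> ua; have : a - p (u - z) <= c.
    by apply: sup_upper_bound => //; exists (u, a).
  by move=> h; lra.
have c2 v b : G (v, b) -> b + c <= p (v + z).
  move=> vb; have : c <= p (v + z) - b by apply: ge_sup; [case: Ssup|exact: Sub].
  by move=> h; lra.
exists [set w | exists v a t, G (v, a) /\ w = (v + toK t *: z, a + t * c)].
split.
- by move=> [v a] va; exists v, a, 0; rewrite toK0 scale0r mul0r !addr0.
- by exists c, 0, 0, 1; rewrite toK1 scale1r mul1r !add0r.
- move=> r u a v b [u' [a' [t [ua [-> ->]]]]] [v' [b' [s [vb [-> ->]]]]].
  exists (toK r *: u' + v'), (r * a' + b'), (r * t + s); split; first exact: Gl.
  congr pair; last by ring.
  by rewrite toKD toKM scalerDl -scalerA scalerDr addrACA.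
- move=> _ _ [v [a [t [va [-> ->]]]]].
  have [t0|t0|->] := ltgtP t 0; last by rewrite toK0 scale0r mul0r !addr0 Gp.
  + have h : toK t *: z = - (toK (- t) *: z) by rewrite toKN scaleNr opprK.
    have := c1 _ _ (GZ (- t)^-1 _ _ va).
    have nt0 : 0 < - t by rewrite oppr_gt0.
    have -> : v + toK t *: z = toK (- t) *: (toK (- t)^-1 *: v - z).
      rewrite scalerBr scalerA -toKM divff ?gt_eqF// toK1 scale1r.
      by rewrite toKN scaleNr opprK.
    rewrite pR gtr0_norm// -(ler_pM2l nt0) => h'; apply: le_trans h'.
    by rewrite mulrBr mulrA divff ?gt_eqF// mul1r mulNr opprK.
  + have := c2 _ _ (GZ t^-1 _ _ va).
    have -> : v + toK t *: z = toK t *: (toK t^-1 *: v + z).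
      by rewrite scalerDr scalerA -toKM divff ?gt_eqF// toK1 scale1r.
    rewrite pR gtr0_norm// -(ler_pM2l t0) => h'; apply: le_trans h'.
    by rewrite mulrDr mulrA divff ?gt_eqF// mul1r.
Qed.

Lemma hahn_banach_real (x0 : V) : exists f : V -> R,
  [/\ forall u v, f (u + v) = f u + f v,
      forall r v, f (toK r *: v) = r * f v,
      f x0 = p x0 & forall v, f v <= p v].
Proof.
pose good G := [/\ G (x0, p x0), real_linear G & dominated G].
have good_line : good [set va | exists t, va = (toK t *: x0, t * p x0)].
  split.
  - by exists 1; rewrite toK1 scale1r mul1r.
  - move=> r _ _ _ _ [t [-> ->]] [s [-> ->]]; exists (r * t + s).
    by rewrite toKD toKM scalerDl scalerA mulrDl mulrA.
  - move=> _ _ [t [-> ->]]; rewrite pR ler_wpM2r// ?p_ge0//.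
    exact: ler_norm.
have [F FP Ftot|A [AP Amax]] := @Zorn_bigcup _ [set G | G = set0 \/ good G].
  have [[X FX gX]|Fno] := pselect (exists2 X, F X & good X); last first.
    left; rewrite -subset0 => va [X FX Xva]; apply: Fno; exists X => //.
    by case: (FP _ FX) => // X0; rewrite X0 in Xva.
  have gF Y va : F Y -> Y va -> good Y.
    by move=> /FP[->|//].
  right; split.
  - by exists X => //; case: gX.
  - move=> r u a v b [Y FY Yu] [Z FZ Zv].
    have [YZ|ZY] := Ftot _ _ FY FZ.
      by exists Z => //; case: (gF _ _ FZ Zv) => _ h _; apply: h => //; exact: YZ.
    by exists Y => //; case: (gF _ _ FY Yu) => _ h _; apply: h => //; exact: ZY.
  - by move=> v a [Y FY Yv]; case: (gF _ _ FY Yv) => _ _; exact.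
have gA : good A.
  case: AP => // A0; exfalso; apply: (Amax _ _ (or_intror good_line)).
  rewrite A0; split => //; first by move=> h; case: good_line => /h.
case: gA => Ax0 Al Ap.
have A0 : A (0, 0).
  have := Al (-1) _ _ _ _ Ax0 Ax0.
  by rewrite toKN toK1 scaleN1r mulN1r !addNr.
have Atot v : exists a, A (v, a).
  have [G [AG [c vc] Gl Gp]] := @extend_one A v A0 Al Ap.
  have [GA|GA] := pselect (G `<=` A); first by exists c; exact: GA.
  exfalso; apply: (Amax G) => //; right; split => //; exact: AG.
(* Single-valuedness comes from domination: the difference of two values at [v] is a value at [0],
   where [p] vanishes. *)
have Auniq v a b : A (v, a) -> A (v, b) -> a = b.
  move=> va vb.
  have := Al (-1) _ _ _ _ va vb; have := Al (-1) _ _ _ _ vb va.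
  rewrite toKN toK1 scaleN1r !mulN1r !addNr => /Ap + /Ap; rewrite p0.
  by move=> h1 h2; apply/eqP; rewrite eq_le; apply/andP; split; lra.
have [f fA] := choice Atot.
exists f; split.
- move=> u v; apply: (Auniq (u + v)) => //.
  by have := Al 1 _ _ _ _ (fA u) (fA v); rewrite toK1 scale1r mul1r.
- move=> r v; apply: (Auniq (toK r *: v)) => //.
  by have := Al r _ _ _ _ (fA v) A0; rewrite !addr0.
- exact: (Auniq x0).
- by move=> v; exact: Ap.
Qed.

End HahnBanachReal.

Section LinearMaps.
Context (K : pzRingType) (V W : lmodType K) (f : V -> W) (fl : linear f).

Lemma linear_map0 : f 0 = 0.
Proof. by have := fl (-1) 0 0; rewrite scaler0 addr0 scaleN1r addNr. Qed.

Lemma linear_mapD u v : f (u + v) = f u + f v.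
Proof. by have := fl 1 u v; rewrite !scale1r. Qed.

Lemma linear_mapZ a v : f (a *: v) = a *: f v.
Proof. by have := fl a v 0; rewrite linear_map0 !addr0. Qed.

Lemma linear_mapB u v : f (u - v) = f u - f v.
Proof. by rewrite linear_mapD -scaleN1r linear_mapZ scaleN1r. Qed.

End LinearMaps.

Section ScalarMaps.
Context (K : pzRingType) (V : lmodType K) (f : V -> K^o) (fl : scalar f).

Lemma scalar0 : f 0 = 0.
Proof. exact: (linear_map0 (W := K^o)). Qed.

Lemma scalarZ a v : f (a *: v) = a * f v.
Proof. exact: (linear_mapZ (W := K^o)). Qed.

Lemma scalarB u v : f (u - v) = f u - f v.
Proof. exact: (linear_mapB (W := K^o)). Qed.

End ScalarMaps.

(** A complex number of modulus at most its real part is real. This upgrades an equality of real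
    parts at [x0] to an equality of scalars. *)
Lemma rn_le_toR (R : realType) (k : scalar_kind) (a : (scalars R k)^o) r :
  rn a <= r -> toR a = r -> a = toK r.
Proof.
rewrite /rn /toR /toK; case: k a => //= a + ar.
rewrite -[leLHS]/(complex.Re `|(a : R[i])|) normc_def /= ar => h.
have r0 : 0 <= r by apply: le_trans h; rewrite sqrtr_ge0.
have {}h : complex.Im a ^+ 2 <= 0.
  rewrite -(lerD2l (r ^+ 2)) addr0 -ler_sqrt ?sqr_ge0//.
  by rewrite (le_trans h)// sqrtr_sqr ger0_norm.
apply/eqP; rewrite eq_complex /= ar eqxx /=.
by rewrite -sqrf_eq0 eq_le h sqr_ge0.
Qed.

Section HahnBanach.
Context {R : realType}.

(* The real functional [f] is the real part of [v |-> f v - i f (i v)]. *)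
Let complexify (V : lmodType R[i]) (f : V -> R) :
  (forall u v, f (u + v) = f u + f v) ->
  (forall r v, f (r%:C%C *: v) = r * f v) ->
  exists F : V -> R[i]^o, scalar F /\ forall v, complex.Re (F v) = f v.
Proof.
move=> fD fZ; exists (fun v => Complex (f v) (- f ('i%C *: v))); split=> //.
have fZc a v : f (a *: v) = complex.Re a * f v + complex.Im a * f ('i%C *: v).
  by rewrite {1}(complexE a) scalerDl fD fZ ['i%C * _]mulrC -scalerA fZ.
have fii v : f ('i%C *: ('i%C *: v)) = - f v.
  rewrite scalerA -expr2 sqr_i scaleN1r.
  by have := fZ (-1) v; rewrite rmorphN rmorph1 scaleN1r mulN1r.
move=> a u v; apply/eqP; rewrite eq_complex; apply/andP; split; apply/eqP => /=.
  by rewrite fD fZc; case: (a) => x y /=; rewrite mulrN opprK.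
rewrite scalerDr fD scalerA [_ * a]mulrC -scalerA fZc fii.
by case: (a) => x y /=; ring.
Qed.

Lemma hahn_banach (k : scalar_kind) (V : lmodType (scalars R k)) (p : V -> R) :
  (forall u v, p (u + v) <= p u + p v) ->
  (forall a v, p (a *: v) = rn (a : (scalars R k)^o) * p v) ->
  forall x0, exists f : V -> (scalars R k)^o,
  [/\ scalar f, f x0 = toK (p x0) & forall v, rn (f v) <= p v].
Proof.
move=> pD pZ x0; have [f [fD fZ fx0 fp]] := hahn_banach_real pD pZ x0.
suff [F [Fl Ff]] : exists F : V -> (scalars R k)^o,
    scalar F /\ forall v, toR (F v) = f v.
  have Fp v : rn (F v) <= p v.
    (* Multiplying [v] by a phase makes [F v] real and nonnegative without changing [p v], so the
       bound on the real part bounds the modulus. *)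
    have [u u1 uF] := rn_phase (F v).
    have {}uF : F (u *: v) = toK (rn (F v)).
      by rewrite scalarZ.
    have := fp (u *: v); rewrite -Ff uF toRK pZ u1 mul1r; exact.
  exists F; split => //; apply: rn_le_toR; first exact: Fp.
  by rewrite Ff.
move: V p pD pZ x0 f fD fZ fx0 fp; case: k => V p pD pZ x0 f fD fZ fx0 fp.
  by exists f; split => // a u v; rewrite fD; congr (_ + _); exact: fZ.
exact: complexify.
Qed.

End HahnBanach.

Section Seminorms.
Context {R : realType} {k : scalar_kind}.
Local Notation K := (scalars R k).

Definition seminorm (V : lmodType K) (p : V -> R) : Prop :=
  (forall u v, p (u + v) <= p u + p v) /\
  (forall a v, p (a *: v) = rn (a : K^o) * p v).

Lemma seminorm0 (V : lmodType K) (p : V -> R) : seminorm p -> p 0 = 0.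
Proof. by move=> [_ pZ]; have := pZ 0 0; rewrite scale0r rn0 mul0r. Qed.

Lemma seminormN (V : lmodType K) (p : V -> R) v : seminorm p -> p (- v) = p v.
Proof. by move=> [_ pZ]; rewrite -scaleN1r pZ rnN rn1 mul1r. Qed.

Lemma seminorm_ge0 (V : lmodType K) (p : V -> R) v : seminorm p -> 0 <= p v.
Proof.
move=> ps; have := ps.1 v (- v); rewrite subrr (seminorm0 ps) (seminormN _ ps).
by move=> h; lra.
Qed.

Lemma seminorm_rn (E : normedModType K) : seminorm (@rn R k E).
Proof. by split; [exact: rnD|exact: rnZ]. Qed.

Lemma seminorm_scale (V : lmodType K) (p : V -> R) c :
  0 <= c -> seminorm p -> seminorm (fun v => c * p v).
Proof.
move=> c0 [pD pZ]; split=> [u v|a v]; last by rewrite pZ mulrCA.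
by rewrite -mulrDr ler_wpM2l.
Qed.

Definition linear_set (V : lmodType K) (D : set V) : Prop :=
  D 0 /\ forall a u v, D u -> D v -> D (a *: u + v).

Section InfimalSeminorm.
Context (V W : lmodType K) (D : set W) (A : W -> V).
Context (p : V -> R) (p' : W -> R).
Hypotheses (Dl : linear_set D) (Al : linear A).
Hypotheses (ps : seminorm p) (ps' : seminorm p').

Let vals v := [set p (v - A w) + p' w | w in D].
Let q v := inf (vals v).

Let vals_inf v : has_inf (vals v).
Proof.
split; first by exists (p (v - A 0) + p' 0), 0 => //; exact: Dl.1.
by exists 0 => _ [w _ <-]; rewrite addr_ge0 ?seminorm_ge0.
Qed.

Let q_le v w : D w -> q v <= p (v - A w) + p' w.
Proof. by move=> Dw; apply: ge_inf; [case: (vals_inf v)|exists w]. Qed.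

Let le_q v c : (forall w, D w -> c <= p (v - A w) + p' w) -> c <= q v.
Proof.
by move=> h; apply: lb_le_inf; [case: (vals_inf v)|move=> _ [w Dw <-]; exact: h].
Qed.

Let qD u v : q (u + v) <= q u + q v.
Proof.
rewrite -lerBlDr; apply: le_q => w Dw; rewrite lerBlDr -lerBlDl.
apply: le_q => w' Dw'; rewrite lerBlDl.
have Dww : D (w + w') by have := Dl.2 1 _ _ Dw Dw'; rewrite scale1r.
apply: (le_trans (q_le _ Dww)).
have -> : u + v - A (w + w') = (u - A w) + (v - A w').
  by rewrite (linear_mapD Al) opprD addrACA.
have := ps.1 (u - A w) (v - A w'); have := ps'.1 w w'; lra.
Qed.

Let q_leZ a v : a != 0 -> q (a *: v) <= rn (a : K^o) * q v.
Proof.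
move=> a0; have ra : 0 < rn (a : K^o) by rewrite rn_gt0.
rewrite -ler_pdivrMl//; apply: le_q => w Dw; rewrite ler_pdivrMl//.
have Daw : D (a *: w) by have := Dl.2 a _ _ Dw Dl.1; rewrite addr0.
apply: (le_trans (q_le _ Daw)).
by rewrite (linear_mapZ Al) -scalerBr ps.2 ps'.2 mulrDr.
Qed.

Let qs : seminorm q.
Proof.
split=> [|a v]; first exact: qD.
have [->|a0] := eqVneq a 0.
  rewrite scale0r rn0 mul0r; apply/eqP; rewrite eq_le; apply/andP; split.
    by apply: (le_trans (q_le _ Dl.1)); rewrite (linear_map0 Al) subrr !seminorm0// addr0.
  by apply: le_q => w _; rewrite addr_ge0 ?seminorm_ge0.
apply/eqP; rewrite eq_le q_leZ//= -ler_pdivlMl ?rn_gt0// -rnV.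
by rewrite (le_trans _ (q_leZ _ _)) ?invr_eq0// scalerA mulVf// scale1r.
Qed.

(** The infimal convolution [q] is a seminorm below [p] whose pullback along [A] is below [p'] on
    [D], so domination by [q] imposes both bounds at once. Taking [p' = 0] makes [f] vanish on the
    image of [D]; a small [p'] makes it small there. *)
Lemma hahn_banach_inf v0 c :
  (forall w, D w -> c <= p (v0 - A w) + p' w) ->
  exists (f : V -> K^o) (c' : R),
    [/\ scalar f, c <= c', f v0 = toK c', forall v, rn (f v) <= p v
      & forall w, D w -> rn (f (A w)) <= p' w].
Proof.
move=> h; have [f [fl fv0 fq]] := hahn_banach qs.1 qs.2 v0.
exists f, (q v0); split => //; first exact: le_q.
  move=> v; apply: (le_trans (fq v)); apply: (le_trans (q_le _ Dl.1)).
  by rewrite (linear_map0 Al) subr0 seminorm0// addr0.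
move=> w Dw; apply: (le_trans (fq _)); apply: (le_trans (q_le _ Dw)).
by rewrite subrr seminorm0// add0r.
Qed.

End InfimalSeminorm.

(* A linear functional on a subspace is given by its graph [G]. *)
Lemma hahn_banach_extension (V : lmodType K) (p : V -> R) (G : set (V * K^o)) :
  seminorm p -> linear_set G -> (forall v a, G (v, a) -> rn a <= p v) ->
  exists f : V -> K^o,
    [/\ scalar f, forall v, rn (f v) <= p v & forall v a, G (v, a) -> f v = a].
Proof.
move=> ps Gl Gp.
have [[w0 Gw0]|G0] := pselect (exists w0, G (w0, 1)); last first.
  exists (fun=> 0); split=> [a u v|v|v a va]; rewrite ?mulr0 ?addr0//.
    by rewrite rn0 seminorm_ge0.
  apply: contrapT => a0; apply: G0; exists (a^-1 *: v).
  have := Gl.2 a^-1 _ _ va Gl.1; rewrite addr0.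
  have -> : a^-1 *: ((v, a) : V * K^o) = (a^-1 *: v, a^-1 * a) by [].
  by rewrite mulVf//; apply/eqP => a1; apply: a0.
have GB u a v b : G (u, a) -> G (v, b) -> G (u - v, a - b).
  move=> ua vb; have := Gl.2 (-1) _ _ vb ua.
  by rewrite scaleN1r => h; rewrite [u - v]addrC [a - b]addrC.
have ps' : seminorm (fun w : V * K^o => rn w.2).
  by split=> [u v|a v]; [exact: rnD|exact: rnZ].
have fstl : linear (fun w : V * K^o => w.1) by [].
(* The graph itself serves as domain, the first projection as [A] and the modulus of the second
   coordinate as [p']. The last bound then forces [f] to vanish wherever the given functional does,
   and to be exactly [1] at [w0]. *)
have [|f [c' [fl c1 fw0 fp fG]]] := hahn_banach_inf Gl fstl ps ps' (v0 := w0) (c := 1).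
  move=> [w a] Gw /=; have := Gp _ _ (GB _ _ _ _ Gw0 Gw).
  by have := rn_le_sub a (1 : K^o); rewrite rn1; lra.
exists f; split => // v a va.
have fw01 : f w0 = 1.
  have := fG _ Gw0; rewrite /= fw0 rn1 rn_toK => h.
  suff -> : c' = 1 by rewrite toK1.
  by have := ler_norm c'; lra.
have Gva : G (v - a *: w0, 0).
  have := Gl.2 (- a) _ _ Gw0 va.
  have -> : - a *: ((w0, 1) : V * K^o) + (v, a) = (- a *: w0 + v, - a * 1 + a) by [].
  by rewrite scaleNr [- _ + v]addrC mulr1 addNr.
have := fG _ Gva; rewrite /= rn0 => h.
have : rn (f (v - a *: w0)) == 0 by rewrite eq_le h rn_ge0.
by rewrite rn_eq0 scalarB// scalarZ// fw01 mulr1 subr_eq0 => /eqP.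
Qed.

End Seminorms.

(** * Norming functionals, extension and Helly's theorem *)

Section DualFacts.
Context {R : realType} {k : scalar_kind}.
Local Notation K := (scalars R k).
Implicit Types E F : normedModType K.

Lemma dual_subE E (f g : dual E) x : (f - g : dual E) x = f x - g x.
Proof. by rewrite -scaleN1r dual_addE dual_scaleE mulN1r. Qed.

Lemma dual_sumE E (n : nat) (F : 'I_n -> dual E) x :
  (\sum_(i < n) F i : dual E) x = \sum_(i < n) F i x.
Proof. by elim/big_rec2: _ => // i a f _ <-; rewrite dual_addE. Qed.

Lemma rn_dual_apply E (f : dual E) x : rn (f x) <= rn f * rn x.
Proof. by rewrite -(@toK_le R k) toKM -3!rnE; exact: dual_norm_bound. Qed.

Lemma rn_dual_apply_le E (f : dual E) x c : rn f <= c -> rn (f x) <= c * rn x.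
Proof. by move=> fc; apply: (le_trans (rn_dual_apply _ _)); rewrite ler_wpM2r ?rn_ge0. Qed.

Lemma rn_dual_le E (f : dual E) c :
  0 <= c -> (forall x, rn (f x) <= c * rn x) -> rn f <= c.
Proof.
move=> c0 fc; rewrite -(@toK_le R k) -rnE; apply: dual_norm_le => x.
rewrite (rnE x) -(@toK1 R k) toK_le => x1.
have -> : `|f x| = toK (rn (f x)) by exact: rnE.
by rewrite toK_le (le_trans (fc x))// ler_piMr.
Qed.

Lemma scalar_dual E (f : E -> K^o) c :
  scalar f -> 0 <= c -> (forall x, rn (f x) <= c * rn x) ->
  exists F : dual E, (forall x, F x = f x) /\ rn F <= c.
Proof.
move=> fl c0 fc.
have fF : f \in @continuous_functional R k E.
  apply: (@functionalP _ _ _ _ (toK c)) => //; first by rewrite -(@toK0 R k) toK_le.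
  move=> x; have -> : `|f x| = toK (rn (f x)) by exact: rnE.
  by rewrite rnE -toKM toK_le.
exists (Sub f fF : dual E); split => //.
by apply: rn_dual_le => // x; exact: fc.
Qed.

Lemma dual_norming E (x : E) : exists2 f : dual E, rn f <= 1 & f x = toK (rn x).
Proof.
have [f [fl fx fp]] := hahn_banach (@rnD R k E) (@rnZ R k E) x.
have [||F [Ff F1]] := @scalar_dual E f 1 fl => //.
  by move=> y; rewrite mul1r.
by exists F; rewrite ?Ff.
Qed.

Lemma adjoint_exists E F (A : E -> F) c :
  linear A -> 0 <= c -> (forall x, rn (A x) <= c * rn x) ->
  exists B : dual F -> dual E,
    [/\ linear B, forall f x, B f x = f (A x) & forall f, rn (B f) <= c * rn f].
Proof.
move=> Al c0 Ac.
have ex (f : dual F) : exists g : dual E, (forall x, g x = f (A x)) /\ rn g <= c * rn f.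
  apply: scalar_dual; rewrite ?mulr_ge0 ?rn_ge0//.
    by move=> a u v; rewrite Al linearP.
  move=> x; apply: (le_trans (rn_dual_apply _ _)).
  by rewrite [c * _]mulrC -mulrA ler_wpM2l ?rn_ge0.
have [B BP] := choice ex.
exists B; split => [a f g|f x|f]; [|exact: (BP f).1|exact: (BP f).2].
by apply: dualP => x; rewrite dual_addE dual_scaleE !(BP _).1.
Qed.

Lemma dual_extension E (Z : submodClosed E) (f : dual (subspace_type Z)) :
  exists2 g : dual E, (forall z : subspace_type Z, g (val z) = f z) & rn g <= rn f.
Proof.
pose G : set (E * K^o) := [set w | exists z, w = (val z, f z)].
have Gl : linear_set G.
  split; first by exists 0; rewrite linear0 raddf0.
  move=> a _ _ [u ->] [v ->]; exists (a *: u + v).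
  by congr pair; rewrite linearP.
have ps := seminorm_scale (rn_ge0 f) (seminorm_rn E).
have [|g [gl gp gG]] := hahn_banach_extension ps Gl.
  by move=> _ _ [z [-> ->]]; exact: rn_dual_apply.
have [g' [g'g g'f]] := scalar_dual gl (rn_ge0 f) gp.
by exists g' => // z; rewrite g'g; apply: gG; exists z.
Qed.

(** An arbitrary linear set [G] stands for the span of [s], which avoids coefficients. The induction
    subtracts from [f] the multiple of [h] that makes it vanish at a point [v] killed by the rest of
    the list. *)
Lemma common_kernel_span E (s : seq (dual E)) (f : dual E) :
  (forall x, (forall g : dual E, g \in s -> g x = 0) -> f x = 0) ->
  forall G, linear_set G -> (forall g : dual E, g \in s -> G g) -> G f.
Proof.
elim: s f => [|h s IH] f fs G Gl Gs.
  suff -> : f = 0 by exact: Gl.1.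
  by apply: dualP => x; exact: fs.
have Gh : G h by apply: Gs; rewrite inE eqxx.
have Gs' g : g \in s -> G g by move=> gs; apply: Gs; rewrite inE gs orbT.
have [[v [vs hv]]|nov] := pselect (exists v, (forall g : dual E, g \in s -> g v = 0) /\ h v != 0).
  pose f' := - (f v / h v) *: h + f.
  have -> : f = (f v / h v) *: h + f' by rewrite /f' addrA scaleNr subrr add0r.
  apply: Gl.2 => //; apply: IH => // x xs.
  rewrite dual_addE dual_scaleE.
  have : f (x - (h x / h v) *: v) = 0.
    apply: fs => g; rewrite inE => /orP[/eqP ->|gs]; rewrite linearB linearZ /=.
      by rewrite divfK// subrr.
    by rewrite (xs g)// (vs g)// mulr0 subr0.
  rewrite linearB linearZ /= => /eqP.
  rewrite subr_eq0 => /eqP ->; rewrite mulNr [_ / _ * f v]mulrAC [f v / _ * _]mulrAC.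
  by rewrite [f v * _]mulrC addNr.
apply: IH => // x xs; apply: fs => g; rewrite inE => /orP[/eqP ->|/xs//].
by apply: contrapT => /eqP hx; apply: nov; exists x.
Qed.

Lemma interpolation E (s : seq (dual E)) (xi : dual (dual E)) :
  exists e, forall g : dual E, g \in s -> g e = xi g.
Proof.
elim: s => [|h s [e es]]; first by exists 0.
have [[v [vs hv]]|nov] := pselect (exists v, (forall g : dual E, g \in s -> g v = 0) /\ h v != 0).
  exists (e + ((xi h - h e) / h v) *: v) => g; rewrite inE => /orP[/eqP ->|gs].
    by rewrite linearD linearZ /= divfK// addrC subrK.
  by rewrite linearD linearZ /= (vs g)// mulr0 addr0 es.
exists e => g; rewrite inE => /orP[/eqP ->|/es//].
suff : [set f : dual E | f e = xi f] h by [].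
apply: (common_kernel_span (s := s)) => // [x xs|].
  by apply: contrapT => /eqP hx; apply: nov; exists x.
split=> /=; first by rewrite linear0.
by move=> a u v /= ue ve; rewrite dual_addE dual_scaleE ue ve linearP.
Qed.

(** If every solution were too large, [e0] would be at distance at least [|xi| + eps] from the
    common kernel of [s], and a functional of norm at most [1] vanishing on that kernel would reach
    this value at [e0]. But it is a combination of [s], on which [xi] and evaluation at [e0] agree,
    so its value is at most [|xi|]. *)
Lemma helly E (s : seq (dual E)) (xi : dual (dual E)) eps : 0 < eps ->
  exists2 e, rn e <= rn xi + eps & forall g : dual E, g \in s -> g e = xi g.
Proof.
move=> eps0; have [e0 e0s] := interpolation s xi.
pose N : set E := [set x | forall g : dual E, g \in s -> g x = 0].
have Nl : linear_set N.
  split=> [g _|a u v uN vN g gs]; first by rewrite linear0.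
  by rewrite linearP /= uN// vN// mulr0 addr0.
apply: contrapT => no.
have big w : N w -> rn xi + eps <= rn (e0 - w) + 0.
  move=> Nw; rewrite addr0 leNgt; apply/negP => small; apply: no.
  exists (e0 - w); first exact: ltW.
  by move=> g gs; rewrite linearB /= Nw// subr0 e0s.
have il : linear (@idfun E) by [].
have zs : @seminorm R k E (fun=> 0).
  by split=> [u v|a v]; rewrite ?addr0 ?mulr0.
have [f [c [fl cbig fe0 f1 fN]]] := hahn_banach_inf Nl il (seminorm_rn E) zs big.
have [||F [Ff F1]] := @scalar_dual E f 1 fl => //.
  by move=> x; rewrite mul1r.
have Fe0 : F e0 = xi F.
  suff : [set f : dual E | f e0 = xi f] F by [].
  apply: (common_kernel_span (s := s)) => // [x /fN /=|].
    rewrite Ff => h; by apply/eqP; rewrite -rn_eq0 eq_le h rn_ge0.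
  split=> /=; first by rewrite linear0.
  by move=> a u v /= ue ve; rewrite dual_addE dual_scaleE ue ve linearP.
have := rn_dual_apply xi F; rewrite -Fe0 Ff fe0 rn_toK.
have := ler_wpM2l (rn_ge0 xi) F1; have := ler_norm c; rewrite mulr1; lra.
Qed.

End DualFacts.

(** * Weak* convergence *)

Section SequentialFacts.
Context {R : realType} {k : scalar_kind}.
Local Notation K := (scalars R k).
Implicit Types E F : normedModType K.

Definition ecvg E (u : nat -> E) (l : E) : Prop :=
  forall e, 0 < e -> exists N, forall n, (N <= n)%N -> rn (u n - l) < e.

Lemma ecvgP E (u : nat -> E) l : ecvg u l <-> u n @[n --> \oo] --> l.
Proof.
split=> [ul|/cvgrPdist_lt ul e e0].
  apply/cvgrPdist_lt => e e0.
  have eE : e = toK (toR e) by rewrite toR_ge0K// ltW.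
  have [|N uN] := ul (toR e); first by rewrite -(@toK_lt R k) toK0 -eE.
  exists N => // n /= Nn; rewrite distrC rnE eE toK_lt; exact: uN.
have [|N _ uN] := ul (toK e); first by rewrite -(@toK0 R k) toK_lt.
exists N => n Nn; have := uN n Nn.
by rewrite /= distrC rnE toK_lt.
Qed.

Lemma ecvg_uniq E (u : nat -> E) l l' : ecvg u l -> ecvg u l' -> l = l'.
Proof.
move=> ul ul'; apply/eqP; rewrite -subr_eq0 -rn_eq0; apply/negPn/negP => h.
have {}h : 0 < rn (l - l') by rewrite lt_def h rn_ge0.
have [N uN] := ul _ (divr_gt0 h (ltr0n _ 2)).
have [N' uN'] := ul' _ (divr_gt0 h (ltr0n _ 2)).
have := uN _ (leq_maxl N N'); have := uN' _ (leq_maxr N N').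
have := rn_sub_trans (u (maxn N N')) l l'; rewrite (rnB l (u _)).
by move=> h1 h2 h3; lra.
Qed.

Lemma ecvg_le E (u : nat -> E) l c :
  ecvg u l -> (exists N, forall n, (N <= n)%N -> rn (u n) <= c) -> rn l <= c.
Proof.
move=> ul [N uc]; apply/ler_addgt0Pr => e e0.
have [N' uN'] := ul _ e0.
have := uN' _ (leq_maxr N N'); have := uc _ (leq_maxl N N').
have := rn_le_sub (u (maxn N N')) l; rewrite rnB.
by move=> h1 h2 h3; lra.
Qed.

Lemma ecvg_subr E (u : nat -> E) l a : ecvg u l -> ecvg (fun n => u n - a) (l - a).
Proof.
move=> ul e /ul[N uN]; exists N => n /uN.
by rewrite opprB addrA subrK.
Qed.

Lemma half_pow_small (c e : R) : 0 < e ->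
  exists N, forall n, (N <= n)%N -> c * 2^-1 ^+ n < e.
Proof.
move=> e0; have [c0|c0] := leP c 0.
  exists 0 => n _; apply: le_lt_trans e0.
  by rewrite mulr_le0_ge0// exprn_ge0// invr_ge0.
exists (Num.truncn (c / e)).+1 => n Nn.
rewrite exprVn ltr_pdivrMr ?exprn_gt0// mulrC -ltr_pdivrMr//.
apply: (lt_trans (truncnS_gt _)).
apply: (@le_lt_trans _ _ n%:R); first by rewrite ler_nat.
by rewrite -natrX ltr_nat ltn_expl.
Qed.

Lemma inv_nat_small (e : R) : 0 < e ->
  exists N, forall n, (N <= n)%N -> n.+1%:R^-1 < e.
Proof.
move=> e0; exists (Num.truncn e^-1) => n Nn.
rewrite -(invrK e) ltf_pV2 ?posrE ?invr_gt0//.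
by apply: (lt_le_trans (truncnS_gt _)); rewrite ler_nat ltnS.
Qed.

Definition seq_complete E : Prop := forall u : nat -> E,
  (forall e, 0 < e -> exists N, forall m n, (N <= m)%N -> (N <= n)%N ->
     rn (u m - u n) < e) -> exists l, ecvg u l.

Lemma complete_seq_complete (X : completeNormedModType K) : seq_complete X.
Proof.
move=> u uC; have /cvg_ex[l ul] : cvg (u n @[n --> \oo]).
  apply: cauchy_cvg; apply/cauchy_ballP => e e0.
  have eE : e = toK (toR e) by rewrite toR_ge0K// ltW.
  have [|N uN] := uC (toR e); first by rewrite -(@toK_lt R k) toK0 -eE.
  pose T := [set x | exists2 n, (N <= n)%N & x = u n].
  exists (T, T); first by split; exists N => // n Nn; exists n.
  move=> [_ _] [/= [m Nm ->] [n Nn ->]].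
  by rewrite -ball_normE /= rnE eE toK_lt; exact: uN.
by exists l; apply/ecvgP.
Qed.

(** The factor [1 - q] turns each bound into the difference of two consecutive [c * q ^+ n], so the
    distances telescope. *)
Lemma geometric_dist E (u : nat -> E) (c q : R) : 0 <= c -> 0 <= q ->
  (forall n, rn (u n.+1 - u n) <= c * (1 - q) * q ^+ n) ->
  forall m n, (n <= m)%N -> rn (u m - u n) <= c * q ^+ n.
Proof.
move=> c0 q0 uc m n nm; apply: (@le_trans _ _ (c * (q ^+ n - q ^+ m))).
  rewrite -(subnK nm); elim: (m - n)%N => [|i IH].
    by rewrite add0n !subrr rn0 mulr0.
  apply: (le_trans (rn_sub_trans (u (i + n)%N) _ _)).
  have := uc (i + n)%N; rewrite -addSn => h.
  apply: (le_trans (lerD h IH)); rewrite addSn exprS.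
  by rewrite le_eqVlt; apply/orP; left; apply/eqP; ring.
by rewrite ler_wpM2l// gerBl exprn_ge0.
Qed.

Lemma geometric_limit E (u : nat -> E) (c : R) (q : R) :
  seq_complete E -> 0 <= c -> 0 <= q <= 2^-1 ->
  (forall n, rn (u n.+1 - u n) <= c * (1 - q) * q ^+ n) ->
  exists l, ecvg u l /\ forall n, rn (l - u n) <= c * q ^+ n.
Proof.
move=> Ec c0 /andP[q0 q1] uc.
have ud := geometric_dist c0 q0 uc.
have [|l ul] := Ec u.
  move=> e e0; have e20 : 0 < e / 2 by rewrite divr_gt0.
  have [N hN] := half_pow_small c e20.
  exists N => m n Nm Nn; apply: (le_lt_trans (rn_sub_trans (u N) _ _)).
  have := ud _ _ Nm; have := ud _ _ Nn; rewrite (rnB (u n)) => h1 h2.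
  have := hN _ (leqnn N).
  have : c * q ^+ N <= c * 2^-1 ^+ N.
    by rewrite ler_wpM2l// lerXn2r// nnegrE// invr_ge0.
  by move=> h3 h4; lra.
exists l; split => // n; apply: ecvg_le (ecvg_subr (u n) ul) _.
by exists n => m nm; exact: ud.
Qed.

End SequentialFacts.

Lemma real_seq_complete (R : realType) (u : nat -> R) :
  (forall e : R, 0 < e -> exists N, forall m n, (N <= m)%N -> (N <= n)%N ->
     `|u m - u n| < e) ->
  exists l : R, forall e : R, 0 < e ->
    exists N, forall n, (N <= n)%N -> `|u n - l| < e.
Proof.
move=> uC; exact: (@complete_seq_complete R RealScalars R^o u uC).
Qed.

Lemma rn_le_Re_Im (R : realType) (a : R[i]) :
  @rn R ComplexScalars (R[i])^o a <= `|complex.Re a| + `|complex.Im a|.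
Proof.
rewrite -[leLHS]/(complex.Re `|a|) normc_def /=.
rewrite -[leRHS]ger0_norm ?addr_ge0// -sqrtr_sqr ler_sqrt ?sqr_ge0//.
rewrite sqrrD !real_normK ?num_real// -addrA [_ *+ 2 + _]addrC addrA.
by rewrite lerDl mulrn_wge0// mulr_ge0.
Qed.

Lemma scalars_seq_complete (R : realType) (k : scalar_kind) :
  @seq_complete R k (scalars R k)^o.
Proof.
case: k => [|u uC]; first exact: complete_seq_complete.
have rnRe (a : R[i]) : `|complex.Re a| <= @rn R ComplexScalars (R[i])^o a.
  rewrite -[leRHS]/(complex.Re `|a|) normc_def /= -sqrtr_sqr.
  by rewrite ler_sqrt ?addr_ge0 ?sqr_ge0// lerDl sqr_ge0.
have rnIm (a : R[i]) : `|complex.Im a| <= @rn R ComplexScalars (R[i])^o a.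
  rewrite -[leRHS]/(complex.Re `|a|) normc_def /= -sqrtr_sqr.
  by rewrite ler_sqrt ?addr_ge0 ?sqr_ge0// lerDr sqr_ge0.
have [|x ux] := @real_seq_complete R (fun n => complex.Re (u n)).
  move=> e /uC[N uN]; exists N => m n Nm Nn.
  by apply: le_lt_trans (uN _ _ Nm Nn); rewrite -raddfB; exact: rnRe.
have [|y uy] := @real_seq_complete R (fun n => complex.Im (u n)).
  move=> e /uC[N uN]; exists N => m n Nm Nn.
  by apply: le_lt_trans (uN _ _ Nm Nn); rewrite -raddfB; exact: rnIm.
exists (Complex x y) => e e0.
have [N uN] := ux _ (divr_gt0 e0 (ltr0n _ 2)).
have [N' uN'] := uy _ (divr_gt0 e0 (ltr0n _ 2)).
exists (maxn N N') => n; rewrite geq_max => /andP[/uN h /uN' h'].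
apply: (le_lt_trans (rn_le_Re_Im _)).
by rewrite [e]splitr ltrD// ?raddfB.
Qed.

(** The history is a finite list padded with [t0]; by the first hypothesis [P u n] depends only on
    the values of [u] before [n], so the padding is harmless. *)
Lemma dependent_choice_history (T : Type) (t0 : T)
    (P : (nat -> T) -> nat -> T -> Prop) :
  (forall u u' n t, (forall m, (m < n)%N -> u m = u' m) -> P u n t -> P u' n t) ->
  (forall u n, (forall m, (m < n)%N -> P u m (u m)) -> exists t, P u n t) ->
  exists u, forall n, P u n (u n).
Proof.
move=> Ploc Pex.
have ex (h : seq T) : exists t', (exists t, P (nth t0 h) (size h) t) ->
    P (nth t0 h) (size h) t'.
  by have [[t ht]|no] := pselect (exists t, P (nth t0 h) (size h) t);
    [exists t|exists t0].
have [next nextP] := choice ex.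
pose fix hist n := if n is m.+1 then rcons (hist m) (next (hist m)) else [::].
have size_hist n : size (hist n) = n by elim: n => //= n IH; rewrite size_rcons IH.
pose u n := next (hist n).
have nth_hist n m : (m < n)%N -> nth t0 (hist n) m = u m.
  elim: n => // n IH; rewrite ltnS leq_eqVlt => /orP[/eqP ->|mn] /=.
    by rewrite nth_rcons size_hist ltnn eqxx.
  by rewrite nth_rcons size_hist mn IH.
exists u => n; elim/ltn_ind: n => n IH.
have [t Pt] := Pex u n IH.
have {}Pt : P (nth t0 (hist n)) (size (hist n)) t.
  by rewrite size_hist; apply: Ploc Pt => m mn; rewrite nth_hist.
have := nextP _ (ex_intro _ t Pt); rewrite size_hist.
by apply: Ploc => m mn; rewrite nth_hist.
Qed.

Section WeakStarSequences.
Context {R : realType} {k : scalar_kind}.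
Local Notation K := (scalars R k).
Implicit Types E F : normedModType K.

Lemma weak_star_cvgP E (u : nat -> dual E) f :
  weak_star_cvg u f <-> forall x, @ecvg R k K^o (fun n => u n x) (f x).
Proof. by split=> h x; apply/ecvgP; exact: h. Qed.

(* One of [x + w] and [x - w] works, as [2 f(w) = f(x + w) - f(x - w)]. *)
Lemma far_point E (f : dual E) (x : E) r : 0 < r ->
  exists2 y, rn (y - x) <= r & 2 * r * rn f <= 3 * rn (f y).
Proof.
move=> r0; have [f0|fn0] := leP (rn f) 0.
  exists x; first by rewrite subrr rn0 ltW.
  apply: (@le_trans _ _ 0); last by rewrite mulr_ge0 ?rn_ge0.
  by rewrite mulr_ge0_le0// mulr_ge0// ltW.
have [z fz] : exists z, 2 * rn f * rn z < 3 * rn (f z).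
  apply: contrapT => no; have : rn f <= 2 / 3 * rn f.
    apply: rn_dual_le => [|z]; first by rewrite mulr_ge0 ?rn_ge0.
    rewrite leNgt; apply/negP => h; apply: no; exists z.
    by lra.
  lra.
have z0 : 0 < rn z.
  rewrite rn_gt0; apply/eqP => z0; move: fz.
  by rewrite z0 linear0 !rn0 !mulr0 ltxx.
pose w := toK (r / rn z) *: z.
have rw : rn w = r by rewrite rnZ rn_toK_ge0 ?divr_ge0 ?rn_ge0 ?(ltW r0)// divfK// gt_eqF.
have fw : 2 * r * rn f <= 3 * rn (f w).
  have -> : f w = toK (r / rn z) * f z by rewrite linearZ.
  rewrite rnM rn_toK_ge0 ?divr_ge0 ?rn_ge0 ?(ltW r0)//.
  have -> : 2 * r * rn f = r / rn z * (2 * rn f * rn z).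
    have zn0 : rn z != 0 by rewrite gt_eqF.
    by field.
  by rewrite [leRHS]mulrCA ler_wpM2l ?divr_ge0 ?rn_ge0 ?(ltW r0)// ltW.
have h : 2 * rn (f w) <= rn (f (x + w)) + rn (f (x - w)).
  have <- : rn (f (x + w) - f (x - w)) = 2 * rn (f w).
    have -> : f (x + w) - f (x - w) = toK 2 * f w.
      rewrite -[2]/(1 + 1) toKD toK1 mulrDl mul1r linearD linearB /=.
      by rewrite opprD opprK addrACA subrr add0r.
    by rewrite rnM rn_toK_ge0.
  by apply: (le_trans (rnD _ _)); rewrite rnN.
have [le|lt] := leP (rn (f (x - w))) (rn (f (x + w))).
  exists (x + w); first by rewrite addrAC subrr add0r rw.
  lra.
exists (x - w); first by rewrite addrAC subrr add0r rnN rw.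
lra.
Qed.

(** Gliding hump. By [far_point], [x (j+1)] lies within [r j] of [x j] and [u (N j)] has modulus at
    least [2/3 r j |u (N j)|] there. The limit [l] is within [r j / 2] of [x (j+1)], so
    [|u (N j) l|] is at least [(2/3 - 1/2) r j |u (N j)|], which exceeds [j]: hence the constant
    [6]. *)
Lemma uniform_boundedness E (u : nat -> dual E) : seq_complete E ->
  (forall x, exists C, forall n, rn (u n x) <= C) -> exists C, forall n, rn (u n) <= C.
Proof.
move=> Ec ub; apply: contrapT => no.
have big C : exists n, C < rn (u n).
  apply: contrapT => h; apply: no; exists C => n; rewrite leNgt; apply/negP => lt.
  by apply: h; exists n.
pose r (j : nat) : R := 3^-1 ^+ j.+1.
have r0 j : 0 < r j by rewrite exprn_gt0.
have [N uN] := choice (fun j => big (6 * j%:R / r j)).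
have ex (jx : nat * E) : exists y, rn (y - jx.2) <= r jx.1 /\
    2 * r jx.1 * rn (u (N jx.1)) <= 3 * rn (u (N jx.1) y).
  by have [y h1 h2] := far_point (u (N jx.1)) jx.2 (r0 jx.1); exists y.
have [next nextP] := choice ex.
pose fix x j := if j is i.+1 then next (i, x i) else 0.
have [|||l [_ ld]] := @geometric_limit R k E x (2^-1) (3^-1) Ec.
- by [].
- by apply/andP; split; lra.
- move=> n; have := (nextP (n, x n)).1; rewrite /r /= exprS => h.
  by apply: (le_trans h); rewrite ler_wpM2r ?exprn_ge0//; lra.
have [C uC] := ub l.
pose j := (Num.truncn C).+1.
have Cj : C < j%:R by exact: truncnS_gt.
have [_ h1] := nextP (j, x j); have h2 := ld j.+1.
have := uN j; rewrite ltr_pdivrMr// => h3.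
move: h1 h2; rewrite /= -/(r j) => h1 h2.
set y := next _ in h1 h2.
have h4 : rn (u (N j) y) <= rn (u (N j) l) + rn (u (N j) (l - y)).
  by rewrite linearB /= [X in _ <= _ + X]rnB; exact: rn_le_sub.
have h5 := rn_dual_apply (u (N j)) (l - y).
have h6 : rn (u (N j)) * rn (l - y) <= rn (u (N j)) * (2^-1 * r j).
  by rewrite ler_wpM2l ?rn_ge0.
have := uC (N j); lra.
Qed.

Lemma weak_star_bounded (X : completeNormedModType K) (u : nat -> dual X) f :
  weak_star_cvg u f -> exists2 C, 0 <= C & forall n, rn (u n) <= C.
Proof.
move=> /weak_star_cvgP uf.
have [|C uC] := uniform_boundedness (@complete_seq_complete R k X) (u := u).
  move=> x; have [N uN] := uf x 1 ltr01.
  exists (rn (f x) + 1 + \sum_(i < N) rn (u i x)) => n.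
  have S0 : 0 <= \sum_(i < N) rn (u i x) by apply: sumr_ge0 => i _; exact: rn_ge0.
  have [nN|Nn] := ltnP n N.
    rewrite (bigD1 (Ordinal nN)) //=.
    have : 0 <= \sum_(i < N | i != Ordinal nN) rn (u i x).
      by apply: sumr_ge0 => i _; exact: rn_ge0.
    by have := rn_ge0 (f x); lra.
  by have := uN n Nn; have := rn_le_sub (f x) (u n x); lra.
by exists C => //; apply: le_trans (uC 0%N); exact: rn_ge0.
Qed.

Definition dense_seq E (d : nat -> E) : Prop :=
  forall x e, 0 < e -> exists n, rn (x - d n) < e.

Lemma separable_dense_seq E : separable_space E -> exists d : nat -> E, dense_seq d.
Proof.
move=> [D Dc Dd].
have open_ball x (e : R) : 0 < e -> exists2 y, D y & rn (x - y) < e.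
  move=> e0; have eK : 0 < toK e :> K by rewrite -(@toK0 R k) toK_lt.
  have [||y [By Dy]] := Dd (ball x (toK e))^°.
  - by exists x; apply: nbhsx_ballx.
  - exact: open_interior.
  exists y => //; have := interior_subset By.
  by rewrite -ball_normE /= rnE toK_lt.
have /countable_injP[h hinj] := Dc.
have ex n : exists y, (exists2 z, D z & h z = n) -> D y /\ h y = n.
  have [[z Dz hz]|no] := pselect (exists2 z, D z & h z = n); first by exists z.
  by exists 0.
have [d dP] := choice ex.
exists d => x e /open_ball -/(_ x)[y Dy xy]; exists (h y).
have [Dd' hd] := dP (h y) (ex_intro2 _ _ y Dy erefl).
by have /hinj -> := hd; rewrite ?inE.
Qed.

Lemma weak_star_cvg_dense E (d : nat -> E) (u : nat -> dual E) (f : dual E) C :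
  dense_seq d -> (forall n, rn (u n) <= C) ->
  (forall i, @ecvg R k K^o (fun n => u n (d i)) (f (d i))) -> weak_star_cvg u f.
Proof.
move=> dd uC ud; apply/weak_star_cvgP => x e e0.
have C0 : 0 <= C by apply: le_trans (uC 0%N); exact: rn_ge0.
pose B := C + rn f + 1.
have B0 : 0 < B by have := rn_ge0 f; rewrite /B; lra.
have [i xi] := dd x (e / (2 * B)) (divr_gt0 e0 (mulr_gt0 (ltr0n _ 2) B0)).
have [N uN] := ud i (e / 2) (divr_gt0 e0 (ltr0n _ 2)).
exists N => n Nn; have h := uN n Nn.
have -> : u n x - f x = u n (x - d i) + (u n (d i) - f (d i)) + f (d i - x).
  by rewrite !linearB /= !addrA !subrK.
have h1 := rnD (u n (x - d i) + (u n (d i) - f (d i))) (f (d i - x)).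
have h2 := rnD (u n (x - d i)) (u n (d i) - f (d i)).
have h3 := rn_dual_apply_le (x - d i) (uC n).
have h4 := rn_dual_apply f (d i - x); rewrite rnB in h4.
have h5 : B * rn (x - d i) <= e / 2.
  move: xi; rewrite invfM mulrA => /ltW; rewrite ler_pdivlMr//.
  by rewrite mulrC.
by rewrite /B in h5; have := rn_ge0 (x - d i); lra.
Qed.

Lemma scalar_pointwise_limit E (u : nat -> E -> K^o) (f : E -> K^o) :
  (forall n, scalar (u n)) -> (forall x, ecvg (fun n => u n x) (f x)) -> scalar f.
Proof.
move=> ul uf a x y; apply: (ecvg_uniq (uf _)) => e e0.
have a0 : 0 < rn (a : K^o) + 1 by have := rn_ge0 (a : K^o); lra.
have [N uN] := uf x _ (divr_gt0 e0 (mulr_gt0 (ltr0n _ 2) a0)).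
have [N' uN'] := uf y _ (divr_gt0 e0 (ltr0n _ 2)).
exists (maxn N N') => n; rewrite geq_max => /andP[/uN + /uN' +].
rewrite ul invfM mulrA ltr_pdivlMr// => h1 h2.
have -> : a * u n x + u n y - (a * f x + f y) = a * (u n x - f x) + (u n y - f y).
  by ring.
apply: (le_lt_trans (rnD _ _)); rewrite rnM.
by have := rn_ge0 (u n x - f x); lra.
Qed.

Lemma dual_series E (u : nat -> dual E) c : 0 <= c ->
  (forall n, rn (u n) <= c * 2^-1 ^+ n.+1) ->
  exists F : dual E, forall x n,
    rn (F x - \sum_(i < n) u i x) <= c * 2^-1 ^+ n * rn x.
Proof.
move=> c0 uc.
have ex (x : E) : exists l : K^o, @ecvg R k K^o (fun n => \sum_(i < n) u i x) l /\
    forall n, rn (l - \sum_(i < n) u i x) <= c * rn x * 2^-1 ^+ n.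
  apply: (@geometric_limit R k K^o _ (c * rn x) (2^-1)).
  - exact: scalars_seq_complete.
  - by rewrite mulr_ge0 ?rn_ge0.
  - by rewrite lexx andbT invr_ge0.
  - move=> n; rewrite big_ord_recr /= addrAC subrr add0r.
    apply: (le_trans (rn_dual_apply_le x (uc n))).
    rewrite exprS le_eqVlt; apply/orP; left; apply/eqP.
    have -> : 1 - 2^-1 = 2^-1 :> R by lra.
    by ring.
have [f fP] := choice ex.
have fl : scalar f.
  apply: (@scalar_pointwise_limit E (fun n x => \sum_(i < n) u i x)) => [n a x y|x].
    by rewrite mulr_sumr -big_split; apply: eq_bigr => i _; exact: linearP.
  exact: (fP x).1.
have fc x : rn (f x) <= c * rn x.
  by have := (fP x).2 0%N; rewrite big_ord0 subr0 expr0 mulr1.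
have [F [Ff _]] := scalar_dual fl c0 fc.
by exists F => x n; rewrite Ff mulrAC; exact: (fP x).2.
Qed.

End WeakStarSequences.

Lemma same_floor (R : realType) (e a b : R) : 0 < e ->
  Num.floor (a / e) = Num.floor (b / e) -> `|a - b| <= e.
Proof.
move=> e0 ab.
have := floor_le (a / e); have := floor_le (b / e).
have := lt_succ_floor (a / e); have := lt_succ_floor (b / e); rewrite ab.
rewrite intrD; set m := (Num.floor _)%:~R => h1 h2 h3 h4.
have aE : a = a / e * e by rewrite divfK ?gt_eqF.
have bE : b = b / e * e by rewrite divfK ?gt_eqF.
rewrite aE bE -mulrBl normrM (gtr0_norm e0); apply: ler_piMl; first exact: ltW.
by rewrite ler_norml; apply/andP; split; lra.
Qed.

Lemma scalar_cells (R : realType) (k : scalar_kind) (e : R) : 0 < e ->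
  exists c : (scalars R k)^o -> int * int, forall a b, c a = c b -> rn (a - b) <= e.
Proof.
case: k => e0 /=.
  exists (fun a : R => (Num.floor (a / e), 0)) => a b [] ab.
  exact: same_floor e0 ab.
have e20 : 0 < e / 2 by rewrite divr_gt0.
exists (fun a : R[i] =>
  (Num.floor (complex.Re a / (e / 2)), Num.floor (complex.Im a / (e / 2)))).
move=> a b [/(same_floor e20) h1 /(same_floor e20) h2].
apply: (le_trans (rn_le_Re_Im _)).
by rewrite [e]splitr lerD// raddfB.
Qed.

Section WeakStarSeparability.
Context {R : realType} {k : scalar_kind}.
Local Notation K := (scalars R k).

(** The values at the first [n] points of [d] are recorded up to cells of diameter at most
    [1/(n+1)]. Codes are countable in number, and one element of [S] is picked for each code that
    occurs; picking inside [S] keeps the later [g l] in [L]. *)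
Lemma weak_star_dense_sequence (E : normedModType K) (d : nat -> E)
    (S : set (dual E)) : S !=set0 ->
  exists g : nat -> dual E, (forall l, S (g l)) /\
    forall f, S f -> forall n, exists l,
      forall i, (i < n)%N -> rn (g l (d i) - f (d i) : K^o) <= n.+1%:R^-1.
Proof.
move=> [g0 Sg0].
have [c cP] := choice (fun n => @scalar_cells R k n.+1%:R^-1 (ltac:(by rewrite invr_gt0))).
pose code n (f : dual E) := [seq c n (f (d i)) | i <- iota 0 n].
have ex (ns : nat * seq (int * int)) : exists g : dual E, S g /\
    ((exists2 f, S f & code ns.1 f = ns.2) -> code ns.1 g = ns.2).
  have [[f Sf fn]|no] := pselect (exists2 f, S f & code ns.1 f = ns.2).
    by exists f.
  by exists g0; split => // h; case: no.
have [g gP] := choice ex.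
exists (fun l => g (odflt (0%N, [::]) (unpickle l))); split=> [l|f Sf n].
  exact: (gP _).1.
exists (pickle (n, code n f)) => i ni; rewrite pickleK /=.
have := (gP (n, code n f)).2 (ex_intro2 _ _ f Sf erefl) => /= h.
apply: cP; have := congr1 (fun s => nth (0, 0) s i) h.
by rewrite !(nth_map 0%N) ?size_iota// nth_iota// add0n.
Qed.

End WeakStarSeparability.

(** * The perturbed embedding *)

Section BiorthogonalSystem.
Context {R : realType} {k : scalar_kind}.
Local Notation K := (scalars R k).
Context (X : completeNormedModType K) (V : normedModType K) (H : X -> V).
Hypotheses (Hl : linear H) (H1 : forall x, rn (H x) <= rn x).
Hypothesis Hcodim : ~ finite_codim (range H).

Let H0 : H 0 = 0 := linear_map0 Hl.
Let HZ a x : H (a *: x) = a *: H x := linear_mapZ Hl a x.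

Section Step.
Context (n : nat) (y : nat -> V) (f : nat -> dual V).
Hypothesis fy : forall i j, (i < n)%N -> (j < n)%N -> f i (y j) = (i == j)%:R.

(** The projection onto the common kernel of the [f i] along the span of the [y i]. *)
Let P v := v - \sum_(i < n) f i v *: y i.
Let C := 1 + \sum_(i < n) rn (f i) * rn (y i).

Let Pl : linear P.
Proof.
move=> a u v; rewrite /P scalerBr addrACA -opprD; congr (_ - _).
rewrite scaler_sumr -big_split /=; apply: eq_bigr => i _.
by rewrite linearP /= scalerDl scalerA.
Qed.

Let PB u v : P (u - v) = P u - P v := linear_mapB Pl u v.

Let fP i v : (i < n)%N -> f i (P v) = 0.
Proof.
move=> ni; rewrite /P linearB linear_sum /= (bigD1 (Ordinal ni))//= big1.
  by rewrite linearZ /= fy// eqxx mulr1 addr0 subrr.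
move=> j ji; rewrite linearZ /= fy// (_ : (i == j) = false) ?mulr0//.
by apply: contraNF ji => /eqP ij; apply/eqP/val_inj.
Qed.

Let P_id v : (forall i, (i < n)%N -> f i v = 0) -> P v = v.
Proof. by move=> fv; rewrite /P big1 ?subr0// => i _; rewrite fv// scale0r. Qed.

Let P0 : P 0 = 0 := linear_map0 Pl.
Let PZ a v : P (a *: v) = a *: P v := linear_mapZ Pl a v.

Let C_ge0 : 0 <= C.
Proof. by rewrite addr_ge0// sumr_ge0// => i _; rewrite mulr_ge0 ?rn_ge0. Qed.

Let PC v : rn (P v) <= C * rn v.
Proof.
apply: (le_trans (rnD _ _)); rewrite rnN mulrDl mul1r lerD2l.
apply: (le_trans (rn_sum _ _ _)); rewrite mulr_suml ler_sum// => i _.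
rewrite rnZ mulrAC ler_wpM2r ?rn_ge0//; exact: rn_dual_apply.
Qed.

Let Py i : (i < n)%N -> P (y i) = 0.
Proof.
move=> ni; rewrite /P (bigD1 (Ordinal ni))//= big1 => [|j ji].
  by rewrite fy// eqxx scale1r addr0 subrr.
rewrite fy// (_ : (_ == _) = false) ?scale0r//.
by apply: contraNF ji => /eqP ij; apply/eqP/val_inj.
Qed.

(* Iterating an approximate solution of [P (H x) = eta], as in the open mapping
   theorem. *)
Let no_far_point (r : R) : 0 < r ->
  (forall eta, P eta = eta -> rn eta <= 1 ->
     exists2 x, rn x <= r & rn (eta - P (H x)) <= 2^-1) -> False.
Proof.
move=> r0 near1; apply: Hcodim.
have near_ eta : exists x, P eta = eta ->
    rn x <= r * rn eta /\ rn (eta - P (H x)) <= 2^-1 * rn eta.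
  have [Peta|Peta] := pselect (P eta = eta); last by exists 0.
  have [->|eta0] := eqVneq eta 0.
    by exists 0; rewrite H0 P0 subrr !rn0 !mulr0.
  have re0 : 0 < rn eta by rewrite rn_gt0.
  have re1 : rn (toK (rn eta)^-1 : K^o) = (rn eta)^-1.
    by rewrite rn_toK_ge0// invr_ge0 ltW.
  have [||x xr xe] := near1 (toK (rn eta)^-1 *: eta).
  - by rewrite PZ Peta.
  - by rewrite rnZ re1 mulVf ?gt_eqF.
  have KK : toK (rn eta) * toK (rn eta)^-1 = 1 :> K.
    by rewrite -toKM divff ?gt_eqF// toK1.
  exists (toK (rn eta) *: x) => _; split.
    by rewrite rnZ rn_toK_ge0 ?rn_ge0// mulrC ler_wpM2r ?rn_ge0.
  have -> : eta - P (H (toK (rn eta) *: x)) =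
      toK (rn eta) *: (toK (rn eta)^-1 *: eta - P (H x)).
    by rewrite scalerBr scalerA KK scale1r HZ PZ.
  by rewrite rnZ rn_toK_ge0 ?rn_ge0// mulrC ler_wpM2r ?rn_ge0.
have [phi phiP] := choice near_.
have onto eta : P eta = eta -> exists x, P (H x) = eta.
  move=> Peta.
  pose fix e m := if m is m'.+1 then e m' - P (H (phi (e m'))) else eta.
  have Pe m : P (e m) = e m.
    elim: m => //= m IH; rewrite PB IH; congr (_ - _).
    by apply: P_id => i ni; exact: fP.
  have re m : rn (e m) <= rn eta * 2^-1 ^+ m.
    elim: m => [|m IH] /=; first by rewrite mulr1.
    apply: (le_trans (phiP _ (Pe m)).2).
    by rewrite exprS mulrCA ler_wpM2l ?invr_ge0.
  pose s m := \sum_(i < m) phi (e i).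
  have [|||l [_ ls]] := @geometric_limit R k X s (2 * (r * rn eta)) (2^-1)
     (@complete_seq_complete R k X).
  - by rewrite !mulr_ge0 ?rn_ge0// ltW.
  - by rewrite lexx andbT invr_ge0.
  - move=> m; rewrite /s big_ord_recr /= addrAC subrr add0r.
    apply: (le_trans (phiP _ (Pe m)).1).
    have := ler_wpM2l (ltW r0) (re m).
    have -> : 1 - 2^-1 = 2^-1 :> R by lra.
    by move=> h; apply: (le_trans h); lra.
  exists l; apply/eqP; rewrite -subr_eq0 -rn_eq0 eq_le rn_ge0 andbT.
  apply/ler_addgt0Pr => eps eps0; rewrite add0r.
  have [N hN] := half_pow_small (rn eta + C * (2 * (r * rn eta))) eps0.
  have es m : eta - P (H (s m)) = e m.
    elim: m => [|m IH] /=.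
      by rewrite /s big_ord0 H0 P0 subr0.
    by rewrite /s big_ord_recr /= -/(s m) (linear_mapD Hl) (linear_mapD Pl) opprD addrA IH.
  have -> : P (H l) - eta = P (H (l - s N)) - e N.
    by rewrite (linear_mapB Hl) -es PB (opprB eta) subrKA.
  apply: (le_trans (rnD _ _)); rewrite rnN.
  have h1 := re N.
  have h2 : rn (P (H (l - s N))) <= C * (2 * (r * rn eta) * 2^-1 ^+ N).
    apply: (le_trans (PC _)); rewrite ler_wpM2l//.
    by apply: (le_trans (H1 _)); exact: ls.
  by have := hN _ (leqnn N); lra.
exists n, (fun i => y i) => v.
have [x Px] : exists x, P (H x) = P v.
  by apply: onto; apply: P_id => i ni; exact: fP.
exists (H x), (fun i => f i (v - H x)); split; first by exists x.
have : P (v - H x) = 0 by rewrite PB Px subrr.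
by rewrite {1}/P => /eqP; rewrite subr_eq0 => /eqP <-; rewrite addrC subrK.
Qed.

(** By [no_far_point] some [eta] in the range of [P] stays at distance at least [1/2] from [P (H x)]
    for all [x] of norm at most [1/eps]. The seminorms [2 |v|] and [eps |x|] then meet the
    separation hypothesis with constant [1]: the first is large inside that ball, the second
    outside. Composing the functional with [P] makes it kill the earlier [y i]. *)
Lemma biorthogonal_step (eps : R) : 0 < eps ->
  exists (eta : V) (g : dual V),
    [/\ rn eta <= 1, g eta = 1, forall i, (i < n)%N -> f i eta = 0,
        forall i, (i < n)%N -> g (y i) = 0
      & forall x, rn (g (H x)) <= eps * rn x].
Proof.
move=> eps0.
have [eta [Peta eta1 far]] : exists eta, [/\ P eta = eta, rn eta <= 1 &
    forall x, rn x <= eps^-1 -> 2^-1 <= rn (eta - P (H x))].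
  apply: contrapT => no; apply: (@no_far_point eps^-1); first by rewrite invr_gt0.
  move=> eta Peta eta1; apply: contrapT => nox; apply: no; exists eta.
  split=> // x xr; rewrite leNgt; apply/negP => lt; apply: nox.
  by exists x => //; exact: ltW.
have ps := seminorm_scale (ler0n R 2) (seminorm_rn V).
have ps' := seminorm_scale (ltW eps0) (seminorm_rn X).
have PHl : linear (P \o H) by move=> a u v /=; rewrite Hl Pl.
have Tl : linear_set [set: X] by [].
have [x _ /=|g [c [gl c1 geta gp gPH]]] :=
    hahn_banach_inf Tl PHl ps ps' (v0 := eta) (c := 1).
  have [xr|xr] := leP (rn x) eps^-1.
    have := far _ xr; have : 0 <= eps * rn x by rewrite mulr_ge0 ?rn_ge0// ltW.
    by move=> h1 h2; lra.
  have : 1 <= eps * rn x by rewrite -ler_pdivrMl// mulr1 ltW.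
  have := rn_ge0 (eta - P (H x)); lra.
have c0 : 0 < c by apply: lt_le_trans c1.
pose g' v := toK c^-1 * g (P v) : K^o.
have g'l : scalar g'.
  by move=> a u v; rewrite /g' Pl gl mulrDr mulrCA.
have rc : rn (toK c^-1 : K^o) <= 1.
  by rewrite rn_toK_ge0 ?invr_ge0 ?(ltW c0)// invf_le1.
have g'C v : rn (g' v) <= 2 * C * rn v.
  rewrite /g' rnM; apply: (@le_trans _ _ (1 * (2 * (C * rn v)))); last first.
    by rewrite mul1r mulrA.
  rewrite ler_pM ?rn_ge0//; apply: (le_trans (gp _)).
  by rewrite ler_wpM2l.
have [G [Gg _]] := scalar_dual g'l (mulr_ge0 (ler0n R 2) C_ge0) g'C.
exists eta, G; split=> //.
- by rewrite Gg /g' Peta geta -toKM mulVf ?gt_eqF// toK1.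
- by move=> i ni; rewrite -Peta fP.
- by move=> i ni; rewrite Gg /g' Py// scalar0// mulr0.
- move=> x; rewrite Gg /g' rnM -[leRHS]mul1r ler_pM ?rn_ge0//.
  exact: gPH.
Qed.

End Step.

Lemma biorthogonal_system (eps : nat -> R) : (forall i, 0 < eps i) ->
  exists (y : nat -> V) (f : nat -> dual V),
    [/\ forall i j, f i (y j) = (i == j)%:R, forall i, rn (y i) <= 1
      & forall i x, rn (f i (H x)) <= eps i * rn x].
Proof.
move=> eps0.
pose Q (u : nat -> V * dual V) n (t : V * dual V) :=
  [/\ rn t.1 <= 1, t.2 t.1 = 1, forall i, (i < n)%N -> (u i).2 t.1 = 0,
      forall i, (i < n)%N -> t.2 (u i).1 = 0
    & forall x, rn (t.2 (H x)) <= eps n * rn x].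
have [||u uQ] := @dependent_choice_history (V * dual V)%type (0, 0) Q.
- move=> u u' n t uu' [t1 tt ut tu tH]; split=> // i ni; rewrite -uu'//.
  + exact: ut.
  + exact: tu.
- move=> u n uQ.
  have fy i j : (i < n)%N -> (j < n)%N -> (u i).2 (u j).1 = (i == j)%:R.
    move=> ni nj; have [ij|ji|->] := ltngtP i j.
    + by have [_ _ -> //] := uQ j nj.
    + by have [_ _ _ -> //] := uQ i ni.
    + by have [_ ->] := uQ j nj.
  have [eta [g [h1 h2 h3 h4 h5]]] :=
    @biorthogonal_step n (fun i => (u i).1) (fun i => (u i).2) fy _ (eps0 n).
  by exists (eta, g).
exists (fun i => (u i).1), (fun i => (u i).2); split=> [i j|i|i x].
- have [ij|ji|->] := ltngtP i j.
  + by have [_ _ -> //] := uQ j.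
  + by have [_ _ _ -> //] := uQ i.
  + by have [_ ->] := uQ j.
- by have [] := uQ i.
- by have [_ _ _ _] := uQ i; exact.
Qed.

End BiorthogonalSystem.

Section Perturbation.
Context {R : realType} {k : scalar_kind}.
Local Notation K := (scalars R k).

Lemma rn_small_eq0 (E : normedModType K) (x : E) c :
  (forall n, rn x <= c * 2^-1 ^+ n) -> x = 0.
Proof.
move=> h; apply/eqP; rewrite -rn_eq0 eq_le rn_ge0 andbT.
apply/ler_addgt0Pr => e e0; rewrite add0r.
have [N hN] := half_pow_small c e0.
by apply: (le_trans (h N)); apply: ltW; exact: hN.
Qed.

Lemma isomorphic_embedding_bounds (V W : normedModType K) (T : {linear V -> W})
    (c c' : R) : 0 < c -> 0 < c' ->
  (forall v, rn (T v) <= c * rn v) -> (forall v, rn v <= c' * rn (T v)) ->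
  isomorphic_embedding T.
Proof.
move=> c0 c'0 Tc Tc'; split.
  move=> v; apply/cvgrPdist_lt => e e0.
  have eE : e = toK (toR e) by rewrite toR_ge0K// ltW.
  have d0 : 0 < toK (toR e / c) :> K.
    by rewrite -(@toK0 R k) toK_lt divr_gt0// -(@toK_lt R k) toK0 -eE.
  near=> w; rewrite -linearB rnE eE toK_lt.
  apply: (le_lt_trans (Tc _)).
  rewrite mulrC -ltr_pdivlMr// -(@toK_lt R k) -rnE.
  near: w; exact: (@cvgr_dist_lt _ _ _ (nbhs v) _ id v).
have ex w : exists v, range T w -> T v = w.
  by have [[v _ vw]|no] := pselect (range T w); [exists v|exists 0].
have [g gP] := choice ex.
have gK : cancel T g.
  move=> v; apply/eqP; rewrite -subr_eq0 -rn_eq0 eq_le rn_ge0 andbT.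
  apply: (le_trans (Tc' _)); rewrite linearB /= gP ?subrr ?rn0 ?mulr0//.
exists g; split => //.
apply/subspace_continuousP => _ [v _ <-].
apply/cvgrPdist_lt => e e0.
have eE : e = toK (toR e) by rewrite toR_ge0K// ltW.
have d0 : 0 < toK (toR e / c') :> K.
  by rewrite -(@toK0 R k) toK_lt divr_gt0// -(@toK_lt R k) toK0 -eE.
near=> w.
have [u _ uw] : range T w by near: w; exact: withinT.
rewrite -uw /from_subspace !gK rnE eE toK_lt; apply: (le_lt_trans (Tc' _)).
rewrite mulrC -ltr_pdivlMr// -(@toK_lt R k) -rnE linearB /= uw.
near: w; apply: cvg_within; exact: (@cvgr_dist_lt _ _ _ (nbhs (T v)) _ id (T v)).
Unshelve. all: by end_near. Qed.

Lemma ecvg_initial (E : normedModType K) (u : nat -> nat -> E) (l : nat -> E) e n :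
  0 < e -> (forall i, ecvg (u^~ i) (l i)) ->
  exists m, forall i, (i < n)%N -> rn (u m i - l i) < e.
Proof.
move=> e0 ul; suff [N uN] : exists N, forall m i, (N <= m)%N -> (i < n)%N ->
    rn (u m i - l i) < e by exists N => i; exact: uN.
elim: n => [|n [N uN]]; first by exists 0%N.
have [N' uN'] := ul n e e0.
exists (maxn N N') => m i; rewrite geq_max => /andP[Nm N'm].
rewrite ltnS leq_eqVlt => /orP[/eqP ->|ni]; [exact: uN'|exact: uN].
Qed.

Context (X : completeNormedModType K) (Y : submodClosed (dual X)).
Hypothesis X_separable : separable_space X.
Hypothesis HY_codim : ~ finite_codim (range (Hmap Y)).

(* For [y_i], [f_i] biorthogonal in [Y^*] and [Y^**] with [|f_i o H_Y|] small,
   the embedding is [T y = y + \sum_i y_i(y) (b_i g_i - f_i o H_Y)]: its second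
   adjoint maps [f_i] to [b_i g_i]. *)
Lemma perturbed_embedding (L : set (dual X)) :
  L 0 -> (forall a f, L f -> L (a *: f)) ->
  exists (T : {linear subspace_type Y -> dual X}) (g : nat -> dual X),
  [/\ isomorphic_embedding T,
      forall y, rn y <= 2 * rn (T y),
      forall l, L (g l),
      forall z, (forall y : dual X, y \in Y -> y z = 0) -> forall y n,
        rn ((T y : dual X) z) <= rn y * (\sum_(l < n) rn (g l z) + 2^-1 ^+ n * rn z)
    & weak_star_limits L `<=` weak_star_limits (weak_star_limits (range T))].
Proof.
move=> L0 LZ; have [d dd] := separable_dense_seq X_separable.
have Hl : linear (Hmap Y).
  by move=> a u v; apply: dualP => y; rewrite dual_addE dual_scaleE !HmapE linearP.
have H1 x : rn (Hmap Y x) <= rn x.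
  apply: rn_dual_le; first exact: rn_ge0.
  by move=> y; rewrite HmapE mulrC; exact: rn_dual_apply.
(* Both [toK (b i) *: g i] and [h i] will have norm at most [b i], so [e i] is bounded by
   [2^-(i+2)]. These bounds sum to [1/2], which keeps the perturbation [D] of norm at most [1/2] and
   [T] bounded below. *)
pose b i : R := 2^-1 ^+ i.+3.
have b0 i : 0 < b i by rewrite exprn_gt0.
have [y [f [fy y1 fH]]] : exists (y : nat -> dual (subspace_type Y))
    (f : nat -> dual (dual (subspace_type Y))),
    [/\ forall i j, f i (y j) = (i == j)%:R, forall i, rn (y i) <= 1
      & forall i x, rn (f i (Hmap Y x)) <= b i * rn x].
  exact: (biorthogonal_system Hl H1 HY_codim b0).
have exh i : exists h : dual X, (forall x, h x = f i (Hmap Y x)) /\ rn h <= b i.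
  apply: scalar_dual => //; last exact: ltW.
  by move=> a u v; rewrite Hl linearP.
have [h hP] := choice exh.
pose S : set (dual X) := [set f | L f /\ rn f <= 1].
have [|g [gS gdense]] := weak_star_dense_sequence d (S := S).
  by exists 0; split=> //=; rewrite rn0.
pose e i : dual X := toK (b i) *: g i - h i.
have ee i : rn (e i) <= 2^-1 ^+ i.+2.
  apply: (le_trans (rnD _ _)); rewrite rnN rnZ rn_toK_ge0 ?(ltW (b0 i))//.
  have : b i * rn (g i) <= b i by rewrite ler_piMr ?(ltW (b0 i))//; exact: (gS i).2.
  by have := (hP i).2; rewrite /b [2^-1 ^+ i.+3]exprS; lra.
have ex (v : subspace_type Y) : exists F : dual X, forall x n,
    rn (F x - \sum_(i < n) y i v * e i x) <= rn v / 2 * 2^-1 ^+ n * rn x.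
  have [||F FP] := @dual_series R k X (fun i => y i v *: e i) (rn v / 2).
  - by rewrite divr_ge0 ?rn_ge0.
  - move=> n; rewrite rnZ -mulrA -exprS ler_pM ?rn_ge0//.
    by have := rn_dual_apply_le v (y1 n); rewrite mul1r.
  - by exists F.
have [D DP] := choice ex.
have Dl : linear D.
  move=> a u v; apply: dualP => x; rewrite dual_addE dual_scaleE.
  apply/eqP; rewrite -subr_eq0; apply/eqP.
  apply: (@rn_small_eq0 _ _ (rn (a *: u + v) / 2 * rn x +
    rn (a : K^o) * (rn u / 2 * rn x) + rn v / 2 * rn x)) => n.
  have := DP (a *: u + v) x n; have := DP u x n; have := DP v x n.
  set s := \sum_(i < n) y i u * e i x; set t := \sum_(i < n) y i v * e i x.
  have -> : \sum_(i < n) y i (a *: u + v) * e i x = a * s + t.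
    rewrite mulr_sumr -big_split; apply: eq_bigr => i _.
    by rewrite linearP /= mulrDl mulrA.
  set w := D (a *: u + v) x => h1 h2 h3.
  have -> : w - (a * D u x + D v x) =
      (w - (a * s + t)) - a * (D u x - s) - (D v x - t).
    by ring.
  have h4 := rnD (w - (a * s + t) - a * (D u x - s)) (- (D v x - t)).
  have h5 := rnD (w - (a * s + t)) (- (a * (D u x - s))).
  have := ler_wpM2l (rn_ge0 (a : K^o)) h2.
  by rewrite !rnN !rnM in h4 h5 *; lra.
pose T0 (v : subspace_type Y) : dual X := val v + D v.
have T0l : linear T0.
  by move=> a u v; rewrite /T0 Dl linearP scalerDr addrACA.
pose TL := GRing.isLinear.Build K (subspace_type Y) (dual X) *:%R T0 T0l.
pose T : {linear subspace_type Y -> dual X} := HB.pack T0 TL.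
have TE v : T v = val v + D v by [].
have D2 v : rn (D v) <= rn v / 2.
  apply: rn_dual_le; first by rewrite divr_ge0 ?rn_ge0.
  by move=> x; have := DP v x 0%N; rewrite big_ord0 subr0 mulr1.
have valE (v : subspace_type Y) : rn (val v) = rn v by [].
have lower v : rn v <= 2 * rn (T v).
  have := rn_le_sub (- D v) (val v); rewrite opprK -TE rnN valE.
  by have := D2 v; lra.
have upper v : rn (T v) <= 2 * rn v.
  have := rnD (val v) (D v); rewrite -TE valE.
  by have := D2 v; have := rn_ge0 v; lra.
exists T, g; split => //.
- exact: (isomorphic_embedding_bounds (ltr0n R 2) (ltr0n R 2) upper lower).
- by move=> l; case: (gS l).
- move=> z Yz v n.
  have hz i : h i z = 0.
    rewrite (hP i).1; have -> : Hmap Y z = 0; last exact: linear0.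
    by apply: dualP => u; rewrite HmapE Yz//; exact: (valP u).
  have -> : (T v : dual X) z = D v z.
    by rewrite TE dual_addE Yz ?add0r//; exact: (valP v).
  have := rn_le_sub (\sum_(i < n) y i v * e i z) (D v z).
  have : rn (\sum_(i < n) y i v * e i z) <= rn v * \sum_(i < n) rn (g i z).
    apply: (le_trans (rn_sum _ _ _)); rewrite mulr_sumr ler_sum// => i _.
    rewrite rnM ler_pM ?rn_ge0//.
      by have := rn_dual_apply_le v (y1 i); rewrite mul1r.
    rewrite /e dual_subE dual_scaleE hz subr0.
    rewrite rnM rn_toK_ge0 ?(ltW (b0 i))// ler_piMl ?rn_ge0//.
    by rewrite /b exprn_ile1 ?invr_ge0// invf_le1// ler1n.
  have := DP v z n; rewrite mulrDr.
  have : 0 <= rn v * (2^-1 ^+ n * rn z).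
    by rewrite !mulr_ge0 ?rn_ge0// exprn_ge0.
  by lra.
(* Helly's theorem imitates [f l] by a bounded sequence [v n] in [Y]: on the first [n] data,
   [v n (d i) = h l (d i)] and [y i (v n)] is the Kronecker symbol. Hence [T (v n)] tends weak* to
   [h l + e l], that is, to [b l] times [g l]. *)
have bg l a : weak_star_limits (range T) (a *: g l).
  have exu n : exists v : subspace_type Y, [/\ rn v <= rn (f l) + 1,
     forall i, (i < n)%N -> (val v : dual X) (d i) = h l (d i) &
     forall i, (i < n)%N -> y i v = (l == i)%:R].
    have [v v1 vs] := helly ([seq Hmap Y (d i) | i <- iota 0 n] ++
      [seq y i | i <- iota 0 n]) (f l) (ltr01 : 0 < 1 :> R).
    exists v; split=> // i ni; last first.
      by rewrite vs ?fy// mem_cat map_f ?orbT// mem_iota.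
    rewrite -HmapE vs ?(hP l).1// mem_cat.
    by rewrite (map_f (fun i => Hmap Y (d i))) ?mem_iota.
  have [v vP] := choice exu.
  pose c : K := a * toK (b l)^-1.
  exists (fun n => T (c *: v n)); split; first by move=> n; exists (c *: v n).
  apply: (weak_star_cvg_dense (C := 2 * (rn (c : K^o) * (rn (f l) + 1))) dd).
    move=> n; apply: (le_trans (upper _)); rewrite ler_wpM2l// rnZ ler_wpM2l ?rn_ge0//.
    by case: (vP n).
  move=> i eps eps0.
  have [N hN] := half_pow_small (rn (c : K^o) * ((rn (f l) + 1) / 2 * rn (d i))) eps0.
  exists (maxn N (maxn i.+1 l.+1)) => n; rewrite !geq_max => /andP[/hN hn /andP[ni nl]].
  apply: le_lt_trans hn.
  have [v1 vd vy] := vP n.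
  have -> : (T (c *: v n) : dual X) (d i) - (a *: g l : dual X) (d i) =
      c * (D (v n) (d i) - \sum_(j < n) y j (v n) * e j (d i)).
    have -> : \sum_(j < n) y j (v n) * e j (d i) = e l (d i).
      rewrite (bigD1 (Ordinal nl))//= vy// eqxx mul1r big1 ?addr0// => j jl.
      rewrite vy// (_ : (l == j) = false) ?mul0r//.
      by apply: contraNF jl => /eqP lj; apply/eqP/val_inj.
    have bb : a = c * toK (b l).
      by rewrite /c -mulrA -toKM mulVf ?gt_eqF// toK1 mulr1.
    rewrite linearZ !dual_scaleE TE dual_addE vd// bb -mulrA -mulrBr.
    congr (_ * _); by rewrite /e dual_subE dual_scaleE opprB addrA [h l _ + _]addrC.
  rewrite rnM -mulrA ler_wpM2l ?rn_ge0//; apply: (le_trans (DP _ _ _)).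
  rewrite mulrAC ler_wpM2r ?exprn_ge0// ler_wpM2r ?rn_ge0//.
  by rewrite ler_wpM2r ?invr_ge0.
move=> F [u [uL uF]].
have [C C0 uC] := weak_star_bounded uF.
have C1 : 0 < C + 1 by lra.
have ck : rn (toK (C + 1) : K^o) = C + 1 by rewrite rn_toK_ge0 ?ltW.
have KK : toK (C + 1) * toK (C + 1)^-1 = 1 :> K by rewrite -toKM divff ?gt_eqF// toK1.
(* Division by [C + 1] brings [u] into the unit ball of [L], where the [g l] are weak* dense; the
   extra [1] keeps the divisor positive. *)
have exl n : exists l, forall i, (i < n)%N ->
    rn ((toK (C + 1) *: g l : dual X) (d i) - F (d i)) <= (C + 2) * n.+1%:R^-1.
  have e0 : 0 < n.+1%:R^-1 :> R by rewrite invr_gt0.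
  have [m um] : exists m, forall i, (i < n)%N ->
      rn (u m (d i) - F (d i) : K^o) < n.+1%:R^-1.
    exact: (ecvg_initial n e0 (fun i => (weak_star_cvgP _ _).1 uF (d i))).
  have Sm : S (toK (C + 1)^-1 *: u m).
    split; first exact: LZ.
    rewrite rnZ rn_toK_ge0 ?invr_ge0 ?(ltW C1)// mulrC ler_pdivrMr// mul1r.
    by have := uC m; lra.
  have [l gl] := gdense _ Sm n.
  exists l => i ni; have := gl i ni; have := um i ni.
  have -> : (toK (C + 1) *: g l : dual X) (d i) - F (d i) =
     toK (C + 1) * (g l (d i) - (toK (C + 1)^-1 *: u m : dual X) (d i))
     + (u m (d i) - F (d i)).
    by rewrite !dual_scaleE mulrBr mulrA KK mul1r addrA subrK.
  move=> h1 h2; apply: (le_trans (rnD _ _)); rewrite rnM ck.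
  have := ler_wpM2l (ltW C1) h2; move: h1.
  by move: (n.+1%:R^-1) => q; lra.
have [l lP] := choice exl.
exists (fun n => toK (C + 1) *: g (l n)); split; first by move=> n; exact: bg.
apply: (weak_star_cvg_dense (C := C + 1) dd).
  by move=> n; rewrite rnZ ck ler_piMr ?(ltW C1)//; exact: (gS _).2.
move=> i eps eps0.
have C2 : 0 < C + 2 by lra.
have [N hN] := inv_nat_small (divr_gt0 eps0 C2).
exists (maxn N i.+1) => n; rewrite geq_max => /andP[/hN hn ni].
apply: (le_lt_trans (lP n i ni)).
by rewrite mulrC -ltr_pdivlMr.
Qed.

End Perturbation.

(** * Weak* sequential closures *)

Section Codimension.
Context {R : realType} {k : scalar_kind}.
Local Notation K := (scalars R k).

Lemma finite_codim_subset (V : lmodType K) (S S' : set V) :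
  S `<=` S' -> finite_codim S -> finite_codim S'.
Proof.
move=> SS' [n [b bP]]; exists n, b => v.
by have [s [c [/SS' S's vE]]] := bP v; exists s, c.
Qed.

Lemma finite_codim_kernel (V : lmodType K) n (F : nat -> V -> K^o) :
  (forall i, (i < n)%N -> scalar (F i)) ->
  finite_codim [set v | forall i, (i < n)%N -> F i v = 0].
Proof.
elim: n => [|n IH] Fl.
  exists 0%N, (fun=> 0) => v; exists v, (fun=> 0); split => //.
  by rewrite big_ord0 addr0.
have [m [b bP]] := IH (fun i ni => Fl i (ltnW ni)).
have Fnl := Fl n (ltnSn n).
have [[w [ws Fw]]|now] := pselect (exists w,
    (forall i, (i < n)%N -> F i w = 0) /\ F n w != 0); last first.
  apply: finite_codim_subset (IH (fun i ni => Fl i (ltnW ni))) => v /= vs i.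
  rewrite ltnS leq_eqVlt => /orP[/eqP ->|]; last exact: vs.
  by apply: contrapT => /eqP Fv; apply: now; exists v.
exists m.+1, (fun i => if unlift ord_max i is Some j then b j else w) => v.
have [s [c [ss vE]]] := bP v.
pose t := F n s / F n w.
exists (s - t *: w), (fun i => if unlift ord_max i is Some j then c j else t).
split.
  move=> i; rewrite ltnS leq_eqVlt => /orP[/eqP ->|ni].
    by rewrite scalarB// scalarZ// /t divfK// subrr.
  have Fil := Fl i (ltnW ni).
  by rewrite scalarB// scalarZ// ss// ws// mulr0 subr0.
rewrite big_ord_recr /= unlift_none vE -addrA; congr (s + _).
rewrite addrCA addNr addr0; apply: eq_bigr => i _.
have -> : widen_ord (leqnSn m) i = lift ord_max i.
  by apply: val_inj; rewrite /= /bump leqNgt ltn_ord.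
by rewrite liftK.
Qed.

End Codimension.

Section WeakStarClosures.
Context {R : realType} {k : scalar_kind}.
Local Notation K := (scalars R k).
Context (E : normedModType K).
Implicit Types (M N : set (dual E)) (A : wellOrder).

Lemma weak_star_limits_incl M : M `<=` weak_star_limits M.
Proof. by move=> f Mf; exists (fun=> f); split => // x; exact: cvg_cst. Qed.

Lemma weak_star_limits_mono M N : M `<=` N -> weak_star_limits M `<=` weak_star_limits N.
Proof. by move=> MN f [u [uM uf]]; exists u; split => // n; exact: MN. Qed.

Lemma closure_below_min M A (w : A) :
  (forall v, ~ wo_lt v w) -> closure_below M w = M.
Proof.
move=> wmin; rewrite closure_belowE; apply/seteqP; split=> f; last by left.
by case=> [[]//|[v /wmin]].
Qed.

Lemma closure_below_limits M A (v w : A) : wo_lt v w ->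
  weak_star_limits (closure_below M v) `<=` closure_below M w.
Proof. by move=> vw f fv; rewrite closure_belowE; right; exists v. Qed.

Lemma closure_below_incl M A (w : A) : M `<=` closure_below M w.
Proof.
elim/(well_founded_ind (@wo_wf A)): w => w IH.
have [[v vw]|no] := pselect (exists v, wo_lt v w).
  move=> f Mf; apply: (closure_below_limits vw).
  by apply: weak_star_limits_incl; exact: IH.
by rewrite closure_below_min// => v vw; apply: no; exists v.
Qed.

Lemma limits_sub_closure_below M A (v w : A) : wo_lt v w ->
  weak_star_limits M `<=` closure_below M w.
Proof.
move=> vw; apply: subset_trans (closure_below_limits vw).
exact: (weak_star_limits_mono (closure_below_incl _)).
Qed.

Lemma weak_star_closure2 M :
  weak_star_limits (weak_star_limits M) `<=` weak_star_closure M (wo_fin 2).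
Proof.
move=> f fM; right; exists (ord_max : 'I_2).
apply: weak_star_limits_mono fM.
exact: (@limits_sub_closure_below _ (wo_fin 2) (ord0 : 'I_2) (ord_max : 'I_2)).
Qed.

Lemma weak_star_limits_vanish M x :
  (forall f, M f -> f x = 0) -> forall f, weak_star_limits M f -> f x = 0.
Proof.
move=> Mx f [u [uM /weak_star_cvgP/(_ x) ux]]; apply: (ecvg_uniq ux) => e e0.
by exists 0%N => n _; rewrite Mx// subrr rn0.
Qed.

(** Vanishing at a point of [X] passes to weak* limits, hence to all closures, whereas a norming
    functional does not vanish at a nonzero point. *)
Lemma weak_star_closure_total M A : weak_star_closure M A = setT -> total_set M.
Proof.
move=> MT x x0; apply: contrapT => no.
have Mx f : M f -> f x = 0.
  by move=> Mf; apply/eqP; apply: contrapT => fx; apply: no; exists f => //; exact/negP.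
have Cx (w : A) : forall f, closure_below M w f -> f x = 0.
  elim/(well_founded_ind (@wo_wf A)): w => w IH f.
  rewrite closure_belowE => -[[_ /Mx//]|[v vw]].
  by apply: weak_star_limits_vanish; exact: IH.
have [f _ fx] := dual_norming x.
have : weak_star_closure M A f by rewrite MT.
move=> fM; have : f x = 0.
  by case: fM => [[_ /Mx]|[v]] //; apply: weak_star_limits_vanish; exact: Cx.
rewrite fx -(@toK0 R k) => /toKI/eqP; rewrite rn_eq0; exact/negP.
Qed.

Lemma rn_bidual_embedding (x : E) : rn (bidual_embedding x) = rn x.
Proof.
apply/eqP; rewrite eq_le; apply/andP; split.
  apply: rn_dual_le; first exact: rn_ge0.
  by move=> f; rewrite bidual_embeddingE mulrC rn_dual_apply.
have [f f1 fx] := dual_norming x.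
have := rn_dual_apply (bidual_embedding x) f.
rewrite bidual_embeddingE fx rn_toK_ge0 ?rn_ge0// => h.
by apply: (le_trans h); rewrite ler_piMr ?rn_ge0.
Qed.

Lemma dual_seq_complete : @seq_complete R k (dual E).
Proof.
suff main (u : nat -> dual E) :
    (forall e : R, 0 < e -> exists N : nat, forall m n, (N <= m)%N -> (N <= n)%N ->
      rn (u m - u n) < e) -> exists l : dual E, ecvg u l by exact: main.
move=> uC.
have ex (x : E) : exists l : K^o, ecvg (fun n => u n x) l.
  apply: scalars_seq_complete => e e0.
  have x0 : 0 < rn x + 1 by have := rn_ge0 x; lra.
  have [N uN] := uC _ (divr_gt0 e0 x0).
  exists N => m n Nm Nn; rewrite -dual_subE.
  apply: (le_lt_trans (rn_dual_apply _ _)).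
  have := uN _ _ Nm Nn; rewrite ltr_pdivlMr// => h.
  by have := rn_ge0 (u m - u n); lra.
have [f fP] := choice ex.
have fl : scalar f.
  by apply: (@scalar_pointwise_limit R k E (fun n x => u n x)) => // n a x y; rewrite linearP.
have fc x e (N : nat) : (forall n m, (N <= n)%N -> (N <= m)%N -> rn (u n - u m) < e) ->
    forall n, (N <= n)%N -> rn (f x - u n x) <= e * rn x.
  move=> uN n Nn; apply: (ecvg_le (ecvg_subr (u n x) (fP x))).
  exists N => m Nm; rewrite -dual_subE; apply: rn_dual_apply_le.
  by apply: ltW; exact: uN.
have [N uN] := uC 1 ltr01.
have [||F [Ff _]] := @scalar_dual R k E f (rn (u N) + 1) fl.
- by have := rn_ge0 (u N); lra.
- move=> x; have := fc x _ _ uN N (leqnn N); have := rn_le_sub (u N x) (f x).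
  by have := rn_dual_apply (u N) x; lra.
exists F => e e0; have e20 : 0 < e / 2 by rewrite divr_gt0.
have [N' uN'] := uC _ e20; exists N' => n N'n.
apply: (@le_lt_trans _ _ (e / 2)); last by lra.
apply: rn_dual_le => [|x]; first exact: ltW.
by rewrite dual_subE Ff rnB; apply: fc uN' _ _.
Qed.

End WeakStarClosures.

Section SecondClosure.
Context {R : realType} {k : scalar_kind}.
Local Notation K := (scalars R k).
Context (X : completeNormedModType K) (Y : submodClosed (dual X)).
Local Notation Z := (preannihilator Y).

Lemma preannihilatorE (z : subspace_type Z) (y : dual X) : y \in Y -> y (val z) = 0.
Proof. by move=> yY; have := valP z; rewrite inE; exact. Qed.

Lemma infinite_dim_kernel n (g : nat -> dual X) :
  ~ finite_dim (subspace_type Z) ->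
  exists z : subspace_type Z, rn z = 1 /\ forall i, (i < n)%N -> g i (val z) = 0.
Proof.
move=> Zinf.
have [z [zg z0]] : exists z : subspace_type Z,
    (forall i, (i < n)%N -> g i (val z) = 0) /\ z != 0.
  apply: contrapT => no; apply: Zinf.
  have [|m [b bP]] := @finite_codim_kernel R k (subspace_type Z) n (fun i z => g i (val z)).
    by move=> i _ a u v; rewrite !linearP.
  exists m, b => v; have [s [c [sg vE]]] := bP v; exists c.
  have [s0|s0] := eqVneq s 0; first by rewrite vE s0 add0r.
  by exfalso; apply: no; exists s.
exists (toK (rn z)^-1 *: z); split.
  by rewrite rnZ rn_toK_ge0 ?invr_ge0 ?rn_ge0// mulVf// rn_eq0.
by move=> i ni; rewrite !linearZ /= zg// mulr0.
Qed.

Lemma embedding_second_closure :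
  separable_space X -> ~ finite_codim (range (Hmap Y)) ->
  exists T : {linear subspace_type Y -> dual X},
    [/\ isomorphic_embedding T, total_set (range T),
        weak_star_closure (range T) (wo_fin 2) = setT
      & ~ finite_dim (subspace_type Z) ->
        weak_star_closure (range T) (wo_fin 1) <> setT].
Proof.
move=> Xsep HYcodim.
have [T [g [Temb Tlow _ Tz Tlim]]] :=
  @perturbed_embedding R k X Y Xsep HYcodim setT I (fun _ _ _ => I).
have T2 : weak_star_closure (range T) (wo_fin 2) = setT.
  apply/seteqP; split=> // f _; apply: weak_star_closure2.
  by apply: Tlim; exact: weak_star_limits_incl.
exists T; split => //; first exact: weak_star_closure_total T2.
move=> Zinf; rewrite weak_star_closure1 => T1.
have [z zP] := choice (fun n => @infinite_dim_kernel n g Zinf).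
(* Each [f] in the first closure is of order [2^-n] at [z n], since the first [n] terms of the
   series for [T y] vanish there. So the [u n] are pointwise bounded on [X^*], although their norms
   are [2^n]. *)
pose u (n : nat) : dual (dual X) := toK (2 ^+ n) *: bidual_embedding (val (z n)).
have [|C uC] := uniform_boundedness (@dual_seq_complete R k X) (u := u).
  move=> f; have [v [vT vf]] : weak_star_limits (range T) f by rewrite T1.
  have [C C0 vC] := weak_star_bounded vf.
  exists (2 * C) => n; rewrite dual_scaleE bidual_embeddingE rnM.
  rewrite rn_toK_ge0 ?exprn_ge0// mulrC -ler_pdivlMr ?exprn_gt0// -exprVn.
  apply: (ecvg_le ((weak_star_cvgP _ _).1 vf (val (z n)))).
  exists 0%N => m _; have [y _ yv] := vT m; have := vC m; rewrite -yv => Ty.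
  have [z1 zg] := zP n.
  apply: (le_trans (Tz _ (fun y yY => preannihilatorE (z n) yY) y n)).
  rewrite big1 ?add0r => [|i _]; last by rewrite zg// rn0.
  have -> : rn (val (z n)) = 1 by exact: z1.
  rewrite mulr1 ler_wpM2r ?exprn_ge0//; apply: (le_trans (Tlow y)).
  by rewrite ler_wpM2l.
have [N hN] := half_pow_small C ltr01.
have := uC N; rewrite rnZ rn_bidual_embedding (_ : rn (val (z N)) = 1); last first.
  by case: (zP N).
rewrite mulr1 rn_toK_ge0 ?exprn_ge0// => h.
have := hN N (leqnn N); rewrite exprVn ltr_pdivrMr ?exprn_gt0// mul1r.
by move=> h'; have := lt_le_trans h' h; rewrite ltxx.
Qed.

End SecondClosure.

(** * Long chains of closures *)

Section BidualRange.
Context {R : realType} {k : scalar_kind}.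
Local Notation K := (scalars R k).

Lemma finite_codim_dual_kernel (V : normedModType K) (s : seq (dual V)) :
  finite_codim [set v : V | forall f : dual V, f \in s -> f v = 0].
Proof.
pose F i : dual V := nth (0 : dual V) s i.
have Fl i : (i < size s)%N -> scalar (F i : V -> K^o) by move=> _; exact: dual_scalar.
apply: finite_codim_subset (finite_codim_kernel Fl) => v /= vs f fs.
by rewrite -(nth_index (0 : dual V) fs); apply: vs; rewrite index_mem.
Qed.

Lemma bidual_embedding_linear (X : normedModType K) : linear (@bidual_embedding R k X).
Proof.
by move=> a x y; apply: dualP => f; rewrite dual_addE dual_scaleE !bidual_embeddingE linearP.
Qed.

(** Completeness makes the canonical image closed: points of [X] approximating [xi] form a Cauchy
    sequence, as the embedding is isometric. So [xi] is at positive distance from the image and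
    Hahn-Banach separates it. *)
Lemma bidual_annihilator (X : completeNormedModType K) (xi : dual (dual X)) :
  ~ range (@bidual_embedding R k X) xi ->
  exists th : dual (dual (dual X)),
    (forall x : X, th (bidual_embedding x) = 0) /\ th xi = 1.
Proof.
move=> xiN; pose J := @bidual_embedding R k X.
have JB x x' : J (x - x') = J x - J x' := linear_mapB (@bidual_embedding_linear X) x x'.
have [e e0 far] : exists2 e, 0 < e & forall x, e <= rn (xi - J x).
  apply: contrapT => no; apply: xiN.
  have near n : exists x, rn (xi - J x) < 2^-1 ^+ n.
    apply: contrapT => h; apply: no; exists (2^-1 ^+ n); first by rewrite exprn_gt0.
    by move=> x; rewrite leNgt; apply/negP => lt; apply: h; exists x.
  have [x xP] := choice near.
  have [|l xl] := @complete_seq_complete R k X x.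
    move=> e e0; have [N hN] := half_pow_small 2 e0.
    exists N => m n Nm Nn; rewrite -rn_bidual_embedding -/J JB.
    apply: (le_lt_trans (rn_sub_trans xi _ _)); rewrite rnB.
    have half_le p : (N <= p)%N -> (2^-1 : R) ^+ p <= 2^-1 ^+ N.
      by move=> Np; apply: ler_wiXn2l => //; rewrite ?invr_ge0// invf_le1// ler1n.
    have := xP m; have := xP n; have := half_le _ Nm; have := half_le _ Nn.
    by have := hN N (leqnn N); lra.
  exists l => //; apply/eqP; rewrite -subr_eq0 -rn_eq0 eq_le rn_ge0 andbT.
  apply/ler_addgt0Pr => e e0; rewrite add0r.
  have [N hN] := half_pow_small 1 (divr_gt0 e0 (ltr0n R 2)).
  have [N' hN'] := xl _ (divr_gt0 e0 (ltr0n R 2)).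
  pose p := maxn N N'.
  have := hN' p (leq_maxr _ _); have := hN p (leq_maxl _ _).
  have := xP p; have := rn_sub_trans (J (x p)) (J l) xi.
  by rewrite -JB rn_bidual_embedding (rnB (J (x p)) xi) (rnB l (x p)); lra.
have Tl : linear_set [set: X] by [].
have zs : @seminorm R k X (fun=> 0) by split=> [u v|a v]; rewrite ?addr0 ?mulr0.
have [|f [c [fl ec fxi f1 fJ]]] := hahn_banach_inf Tl
  (@bidual_embedding_linear X) (seminorm_rn (dual (dual X))) zs (v0 := xi) (c := e).
  by move=> x _; rewrite addr0; exact: far.
have c0 : 0 < c by apply: lt_le_trans ec.
have [||F [Ff _]] := @scalar_dual R k (dual (dual X)) f 1 fl => //.
  by move=> v; rewrite mul1r.
exists (toK c^-1 *: F); split=> [x|]; rewrite dual_scaleE Ff.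
  have := fJ x I => h; have -> : f (bidual_embedding x) = 0; last by rewrite mulr0.
  by apply/eqP; rewrite -rn_eq0 eq_le h rn_ge0.
by rewrite fxi -toKM mulVf ?gt_eqF// toK1.
Qed.

End BidualRange.

(** * Rows approximating elements of the bidual outside the space *)

Section RowSystem.
Context {R : realType} {k : scalar_kind}.
Local Notation K := (scalars R k).
Context (X : completeNormedModType K) (Y : submodClosed (dual X)).
Local Notation Z := (subspace_type (preannihilator Y)).
Hypothesis Z_nonquasireflexive : ~ quasireflexive Z.

(* Row [i] is a bounded sequence [s i m] in [Z] approximating some
   [z_i \in Z^** \ Z] on larger and larger finite sets of functionals; the
   [y i m] separate the increments [s i m - s i m.-1] from each other. *)
Lemma row_system (d : nat -> X) (g : nat -> dual X) :
  exists (s : nat -> nat -> X) (y : nat -> nat -> dual X) (C : nat -> R),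
  [/\ [/\ forall i m (f : dual X), f \in Y -> f (s i m) = 0,
        forall i m, rn (s i m) <= 2 &
        forall i m, (m < i)%N -> s i m = 0],
      forall l m, (l <= m)%N -> forall i, g l (s i m) = g l (s i l),
      forall i m, (i <= m)%N -> rn (y i m) <= C i,
      forall i m l, (i <= m)%N -> (l < m)%N ->
        y i m (d l) = 0 /\ forall j, y i m (s j l) = 0 &
      forall i m l, (i <= m)%N -> (m <= l)%N ->
        forall j, y i m (s j l) = (i == j)%:R].
Proof.
have [res [resl resE res1]] : exists res : dual X -> dual Z,
    [/\ linear res, forall f x, res f x = f (val x)
      & forall f, rn (res f) <= 1 * rn f].
  by apply: adjoint_exists => // z; rewrite mul1r.
have [ext [extl extE ext1]] : exists ext : dual (dual Z) -> dual (dual X),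
    [/\ linear ext, forall f x, ext f x = f (res x)
      & forall f, rn (ext f) <= 1 * rn f].
  exact: adjoint_exists.
have [ext' [_ ext'E _]] : exists ext' : dual (dual (dual X)) -> dual (dual (dual Z)),
    [/\ linear ext', forall f x, ext' f x = f (ext x)
      & forall f, rn (ext' f) <= 1 * rn f].
  exact: adjoint_exists.
(* If [ext ze] is evaluation at [x], it vanishes on [Y] because [res] does, so [x] lies in [Z]. As
   [res] is onto by extension of functionals, [ze] is then evaluation at [x]. *)
have extN ze : ~ range (@bidual_embedding R k Z) ze ->
    ~ range (@bidual_embedding R k X) (ext ze).
  move=> zeN [x _ xze]; apply: zeN.
  have xZ : x \in preannihilator Y.
    rewrite inE => f fY; rewrite -bidual_embeddingE xze extE.
    have -> : res f = 0; last exact: linear0.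
    by apply: dualP => z; rewrite resE preannihilatorE.
  exists (Sub x xZ) => //; apply: dualP => f; rewrite bidual_embeddingE.
  have [h hf _] := dual_extension f.
  have -> : f = res h by apply: dualP => z; rewrite resE hf.
  by rewrite resE SubK -extE -xze bidual_embeddingE.
pose T := ((dual (dual Z) * dual (dual (dual X))) * ((nat -> dual X) * (nat -> Z)))%type.
pose ze (v : nat -> T) m : dual (dual Z) := (v m).1.1.
pose La (v : nat -> T) m : dual (dual (dual X)) := (v m).1.2.
pose yy (v : nat -> T) m : nat -> dual X := (v m).2.1.
pose ss (v : nat -> T) m : nat -> Z := (v m).2.2.
(* Stage [n] picks [ze n] in [Z^**], then [La n] in [X^***] annihilating [X] and biorthogonal to the
   [ze i], then by Helly functionals [yy n i] imitating [La i] and vectors [ss n j] imitating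
   [ze j]. Since [ze n] kills [g l] for [l < n] and all earlier [yy], the later entries of row [n]
   vanish on these functionals, just like its zero entries before index [n]. *)
pose Q1 n v := [/\ rn (ze v n) <= 1,
  forall l, (l < n)%N -> ze v n (res (g l)) = 0,
  forall m i, (m < n)%N -> (i <= n)%N -> ze v n (res (yy v m i)) = 0 &
  forall i, (i < n)%N -> La v i (ext (ze v n)) = 0].
pose Q2 n v := [/\ forall x, La v n (bidual_embedding x) = 0,
  forall i, (i < n)%N -> La v n (ext (ze v i)) = 0 &
  La v n (ext (ze v n)) = 1].
pose Q3 n v := forall i, (i <= n)%N ->
  [/\ rn (yy v n i) <= rn (La v i) + 1,
    forall l, (l < n)%N -> yy v n i (d l) = 0,
    forall m j, (m < n)%N -> yy v n i (val (ss v m j)) = 0 &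
    forall j, (j <= n)%N -> ze v j (res (yy v n i)) = (i == j)%:R].
pose Q4 n v := forall j, if (j <= n)%N then
  [/\ rn (ss v n j) <= 2,
    forall l, (l <= n)%N -> g l (val (ss v n j)) = ze v j (res (g l)) &
    forall m i, (m <= n)%N -> (i <= n)%N ->
      yy v m i (val (ss v n j)) = ze v j (res (yy v m i))]
  else ss v n j = 0.
(* The conditions [Q] speak of a whole sequence; [patch] keeps the history before [n] and puts the
   candidate [t] from [n] on. *)
pose patch (u : nat -> T) n t m := if (m < n)%N then u m else t.
pose Q n v := [/\ Q1 n v, Q2 n v, Q3 n v & Q4 n v].
have patchE (u : nat -> T) n m : (m <= n)%N -> patch u n (u n) m = u m.
  by rewrite /patch leq_eqVlt => /orP[/eqP ->|->//]; rewrite ltnn.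
have Qpatch u n : Q n (patch u n (u n)) -> Q n u.
  have pn m : (m < n)%N -> patch u n (u n) m = u m by move=> /ltnW; exact: patchE.
  case=> [[h1 h2 h3 h4] [h5 h6 h7] h8 h9]; rewrite /Q3 /Q4 /ze /La /yy /ss in h1 h2 h3 h4 h5 h6 h7 h8 h9.
  rewrite (patchE u n n)// in h1 h2 h3 h4 h5 h6 h7 h8 h9.
  rewrite /Q /Q1 /Q2 /Q3 /Q4 /ze /La /yy /ss; split; [split|split| |] => //.
  - by move=> m i mn; rewrite -(pn m mn); exact: h3.
  - by move=> i ni; rewrite -(pn i ni); exact: h4.
  - by move=> i ni; rewrite -(pn i ni); exact: h6.
  - move=> i ni; have [a1 a2 a3 a4] := h8 i ni; split => //.
    + by rewrite -(patchE u n i ni).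
    + by move=> m j mn; rewrite -(pn m mn); exact: a3.
    + by move=> j jn; rewrite -(patchE u n j jn); exact: a4.
  - move=> j; have := h9 j; rewrite /ze /La /yy /ss.
    case: ifP => // jn; rewrite !patchE//.
    case=> a1 a2 a3; split=> // m i mn ni.
    by rewrite -(patchE u n m mn); exact: a3.
have [||u uQ] := @dependent_choice_history T (0, 0, (fun=> 0, fun=> 0))
    (fun u n t => Q n (patch u n t)).
- move=> u u' n t uu'; suff -> : patch u n t = patch u' n t by [].
  by apply/funext => m; rewrite /patch; case: ifP => // /uu'.
- move=> u n uQ; have {}uQ m (mn : (m < n)%N) := Qpatch u m (uQ m mn).
  have delta i j : (i < n)%N -> (j < n)%N -> La u i (ext (ze u j)) = (i == j)%:R.
    move=> ni nj; have [ij|ji|->] := ltngtP i j.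
    + by have [[_ _ _ h] _ _ _] := uQ j nj; rewrite h.
    + by have [_ [_ h _] _ _] := uQ i ni; rewrite h.
    + by have [_ [_ _ h] _ _] := uQ j nj; rewrite h.
  pose Ls : seq (dual (dual (dual Z))) :=
    [seq bidual_embedding (res (g l)) | l <- iota 0 n] ++
    [seq bidual_embedding (res (yy u m i)) | m <- iota 0 n, i <- iota 0 n.+1] ++
    [seq ext' (La u i) | i <- iota 0 n].
  (* Finitely many conditions cut out a subspace of finite codimension in [Z^**]; were it inside the
     canonical image of [Z], then [Z] would be quasireflexive. *)
  have [zt [ztk ztN]] : exists zt : dual (dual Z),
      (forall f : dual (dual (dual Z)), f \in Ls -> f zt = 0) /\
      ~ range (@bidual_embedding R k Z) zt.
    apply: contrapT => no; apply: Z_nonquasireflexive.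
    apply: finite_codim_subset (finite_codim_dual_kernel Ls) => v vs.
    by apply: contrapT => vN; apply: no; exists v.
  have zt0 : 0 < rn zt.
    rewrite rn_gt0; apply/eqP => zt0; apply: ztN; exists 0 => //.
    by rewrite zt0; apply: dualP => f; rewrite bidual_embeddingE linear0.
  pose z : dual (dual Z) := toK (rn zt)^-1 *: zt.
  have z1 : rn z <= 1.
    by rewrite rnZ rn_toK_ge0 ?invr_ge0 ?rn_ge0// mulVf// gt_eqF.
  have zN : ~ range (@bidual_embedding R k Z) z.
    move=> [x _ xz]; apply: ztN; exists (toK (rn zt) *: x) => //.
    apply: dualP => f; rewrite bidual_embeddingE linearZ /= -bidual_embeddingE xz.
    by rewrite dual_scaleE mulrA -toKM divff ?gt_eqF// toK1 mul1r.
  have zk (f : dual (dual (dual Z))) : f \in Ls -> f z = 0.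
    by move=> fL; rewrite /z linearZ /= ztk// mulr0.
  have [th [thJ thz]] := bidual_annihilator (extN _ zN).
  (* This makes [th] vanish at the earlier [ext (ze u i)]. Its value at [ext z] stays [1], because
     [zt] was chosen so that the earlier [La u i] vanish there. *)
  pose L : dual (dual (dual X)) := th - \sum_(i < n) th (ext (ze u i)) *: La u i.
  have LE (f : dual (dual X)) : L f = th f - \sum_(i < n) th (ext (ze u i)) * La u i f.
    by rewrite /L dual_subE dual_sumE; congr (_ - _); apply: eq_bigr.
  pose zz j := if (j < n)%N then ze u j else z.
  pose LL i := if (i < n)%N then La u i else L.
  have LLz i j : (i <= n)%N -> (j <= n)%N -> LL i (ext (zz j)) = (i == j)%:R.
    rewrite /LL /zz [(i <= n)%N]leq_eqVlt [(j <= n)%N]leq_eqVlt.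
    have Laz i' : (i' < n)%N -> La u i' (ext z) = 0.
      move=> ni'; rewrite -ext'E zk// !mem_cat; apply/or3P/Or33.
      by apply: map_f; rewrite mem_iota.
    move=> /orP[/eqP ->|ni] /orP[/eqP ->|nj].
    + rewrite ltnn eqxx LE thz big1 ?subr0// => i' _.
      by rewrite Laz// mulr0.
    + rewrite ltnn nj LE (bigD1 (Ordinal nj))//= delta// eqxx mulr1 big1 ?addr0.
        by rewrite subrr gtn_eqF.
      move=> i' i'j; rewrite delta// (_ : (_ == _) = false) ?mulr0//.
      by apply: contraNF i'j => /eqP ij; apply/eqP/val_inj.
    + by rewrite ltnn ni Laz// ltn_eqF.
    + by rewrite ni nj delta.
  have LLJ i x : LL i (bidual_embedding x) = 0.
    rewrite /LL; case: ifP => ni; first by have [_ [h _ _] _ _] := uQ i ni; rewrite h.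
    rewrite LE thJ big1 ?subr0// => i' _.
    by have [_ [h _ _] _ _] := uQ i' (ltn_ord i'); rewrite h mulr0.
  have exy i : exists f : dual X, [/\ rn f <= rn (LL i) + 1,
      forall l, (l < n)%N -> f (d l) = 0,
      forall m j, (m < n)%N -> f (val (ss u m j)) = 0 &
      forall j, (i <= n)%N -> (j <= n)%N -> zz j (res f) = (i == j)%:R].
    have [f f1 fs] := helly ([seq bidual_embedding (d l) | l <- iota 0 n] ++
      [seq bidual_embedding (val (ss u m j)) | m <- iota 0 n, j <- iota 0 n] ++
      [seq ext (zz j) | j <- iota 0 n.+1]) (LL i) (ltr01 : 0 < 1 :> R).
    exists f; split=> // [l ln|m j mn|j ni nj].
    + rewrite -bidual_embeddingE fs ?LLJ// !mem_cat; apply/or3P/Or31.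
      by rewrite (map_f (fun l => bidual_embedding (d l)))// mem_iota.
    + have [jm|mj] := leqP j m; last first.
        by have [_ _ _ /(_ j)] := uQ m mn; rewrite leqNgt mj /= => ->; rewrite !raddf0.
      rewrite -bidual_embeddingE fs ?LLJ// !mem_cat; apply/or3P/Or32.
      apply: (allpairs_f (fun m j => bidual_embedding (val (ss u m j)))).
        by rewrite mem_iota.
      by rewrite mem_iota (leq_ltn_trans jm).
    + rewrite -extE fs ?LLz// !mem_cat; apply/or3P/Or33.
      by rewrite (map_f (fun j => ext (zz j)))// mem_iota.
  have [y yP] := choice exy.
  pose yv m i := if (m < n)%N then yy u m i else y i.
  have exs j : exists x : Z, if (j <= n)%N then
      [/\ rn x <= 2, forall l, (l <= n)%N -> g l (val x) = zz j (res (g l)) &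
        forall m i, (m <= n)%N -> (i <= n)%N -> yv m i (val x) = zz j (res (yv m i))]
      else x = 0.
    case jn: (j <= n)%N; last by exists 0.
    have [x x1 xs] := helly ([seq res (g l) | l <- iota 0 n.+1] ++
      [seq res (yv m i) | m <- iota 0 n.+1, i <- iota 0 n.+1]) (zz j)
      (ltr01 : 0 < 1 :> R).
    exists x; split=> [|l ln|m i mn ni].
    + apply: (le_trans x1); have : rn (zz j) <= 1; last by lra.
      by rewrite /zz; case: ifP => // nj; have [[]] := uQ j nj.
    + rewrite -resE xs// mem_cat (map_f (fun l => res (g l)))// mem_iota; exact: ln.
    + rewrite -resE xs// mem_cat.
      rewrite (allpairs_f (fun m i => res (yv m i))) ?orbT//.
        by rewrite mem_iota; exact: mn.
      by rewrite mem_iota; exact: ni.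
  have [s sP] := choice exs.
  exists ((z, L), (y, s)); set v := patch u n _.
  have zzE j : ze v j = zz j by rewrite /ze /zz /v /patch; case: ifP.
  have LLE j : La v j = LL j by rewrite /La /LL /v /patch; case: ifP.
  have yvE m i : yy v m i = yv m i by rewrite /yy /yv /v /patch; case: ifP.
  have ssE : ss v n = s by rewrite /ss /v /patch ltnn.
  have ssE' m : (m < n)%N -> ss v m = ss u m by rewrite /ss /v /patch => ->.
  have zn : zz n = z by rewrite /zz ltnn.
  have yn : yv n = y by rewrite /yv ltnn.
  split; [split|split| |].
  + by rewrite zzE zn.
  + move=> l ln; rewrite zzE zn -bidual_embeddingE zk// !mem_cat; apply/or3P/Or31.
    by rewrite (map_f (fun l => bidual_embedding (res (g l))))// mem_iota.
  + move=> m i mn ni; rewrite zzE yvE zn /yv mn -bidual_embeddingE zk// !mem_cat.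
    apply/or3P/Or32; apply: (allpairs_f (fun m i => bidual_embedding (res (yy u m i)))).
      by rewrite mem_iota.
    by rewrite mem_iota; exact: ni.
  + by move=> i ni; rewrite LLE zzE LLz// ?(ltnW ni)// ltn_eqF.
  + by move=> x; rewrite LLE LLJ.
  + by move=> i ni; rewrite LLE zzE LLz ?gtn_eqF// ltnW.
  + by rewrite LLE zzE LLz ?eqxx.
  + move=> i ni; rewrite yvE yn LLE; have [a1 a2 a3 a4] := yP i; split=> //.
    * by move=> m j mn; rewrite ssE'//; exact: a3.
    * by move=> j jn; rewrite zzE; exact: a4.
  + move=> j; have := sP j; rewrite ssE; case jn: (j <= n)%N => // -[a1 a2 a3]; split=> //.
    * by move=> l ln; rewrite zzE a2.
    * by move=> m i mn ni; rewrite zzE yvE a3.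
have {}uQ n := Qpatch _ _ (uQ n).
exists (fun i m => val (ss u m i)), (fun i m => yy u m i), (fun i => rn (La u i) + 1).
have s0 j m : (m < j)%N -> ss u m j = 0.
  by move=> mj; have [_ _ _ /(_ j)] := uQ m; rewrite leqNgt mj.
split; first split.
- by move=> i m f fY; exact: preannihilatorE.
- move=> i m; have [im|mi] := leqP i m; last by rewrite s0// raddf0 rn0.
  by have [_ _ _ /(_ i)] := uQ m; rewrite im => -[].
- by move=> i m mi; rewrite s0// raddf0.
- move=> l m lm i; have [il|li] := leqP i l.
    have [_ _ _ /(_ i)] := uQ m; rewrite (leq_trans il lm) => -[_ h _].
    have [_ _ _ /(_ i)] := uQ l; rewrite il => -[_ h' _].
    by rewrite h// h'.
  rewrite (s0 i l)// !raddf0.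
  have [im|mi] := leqP i m; last by rewrite s0// !raddf0.
  have [_ _ _ /(_ i)] := uQ m; rewrite im => -[_ h _]; rewrite h//.
  by have [[_ -> //]] := uQ i.
- by move=> i m im; have [_ _ /(_ i im)[]] := uQ m.
- move=> i m l im lm; have [_ _ /(_ i im)[_ h1 h2 _] _] := uQ m.
  by split; [exact: h1|move=> j; exact: h2].
- move=> i m l im ml j.
  have [jl|lj] := leqP j l; last first.
    rewrite s0// !raddf0 (_ : (i == j) = false)//; apply/eqP => ij.
    by have := leq_ltn_trans (leq_trans im ml) lj; rewrite ij ltnn.
  have [_ _ _ /(_ j)] := uQ l; rewrite jl => -[_ _ h]; rewrite h ?(leq_trans im ml)//.
  have [jm|mj] := leqP j m.
    by have [_ _ /(_ i im)[_ _ _ ->]] := uQ m.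
  have [[_ _ -> //]] := uQ j; last by rewrite (leq_trans im)// ltnW.
  by rewrite (_ : (i == j) = false)//; apply/eqP => ij; move: mj; rewrite -ij ltnNge im.
Qed.

End RowSystem.

Section WellOrders.
Context (B : wellOrder).
Implicit Types u v w : B.

Lemma wo_irr v : ~ wo_lt v v.
Proof.
elim/(well_founded_ind (@wo_wf B)): v => v IH vv; exact: (IH v vv).
Qed.

Lemma wo_lt_nlt u v w : wo_lt u v -> ~ wo_lt w v -> wo_lt u w.
Proof.
move=> uv wv; have [//|uw|wu] := wo_total u w; first by rewrite uw in uv.
by case: wv; exact: wo_trans uv.
Qed.

Lemma wo_nlt_lt u v w : ~ wo_lt v u -> wo_lt v w -> wo_lt u w.
Proof.
move=> vu vw; have [uv|->//|/vu//] := wo_total u v; exact: wo_trans vw.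
Qed.

Lemma wo_nlt_trans u v w : ~ wo_lt v u -> ~ wo_lt w v -> ~ wo_lt w u.
Proof. by move=> vu wv wu; apply: vu; exact: wo_nlt_lt wu. Qed.

Lemma wo_seq_max (s : seq B) w u0 : wo_lt u0 w -> (forall v, List.In v s -> wo_lt v w) ->
  exists u, [/\ wo_lt u w, ~ wo_lt u u0 & forall v, List.In v s -> ~ wo_lt u v].
Proof.
move=> u0w; elim: s => [|v s IH] sw; first by exists u0; split => //; exact: wo_irr.
have [|u [uw uu0 us]] := IH; first by move=> v' sv'; apply: sw; right.
have [uv|uv] := pselect (wo_lt u v); last first.
  by exists u; split => // v' /= [<-//|]; exact: us.
exists v; split; first by apply: sw; left.
- by move=> vu0; apply: uu0; exact: wo_trans uv vu0.
- move=> v' /= [->|/us uv' vv']; first exact: wo_irr.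
  by apply: uv'; exact: wo_trans uv vv'.
Qed.

Lemma cofinal_sequence (h : B -> nat) : injective h -> forall v,
  exists e : nat -> B, if `[< exists u, wo_lt u v >] then
    (forall m, wo_lt (e m) v) /\
    forall u, wo_lt u v -> exists N, forall m, (N <= m)%N -> ~ wo_lt (e m) u
  else forall m, e m = v.
Proof.
move=> hinj v; case: asboolP => [[u0 u0v]|_]; last by exists (fun=> v).
have ex n : exists u, wo_lt u v /\ forall u', wo_lt u' v -> h u' = n -> u' = u.
  have [[u' u'v hu']|no] := pselect (exists2 u', wo_lt u' v & h u' = n).
    by exists u'; split => // u'' _ hu''; apply: hinj; rewrite hu' hu''.
  by exists u0; split => // u' u'v hu'; case: no; exists u'.
have [q qP] := choice ex.
pose fix e m := if m is m'.+1 then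
  if `[< wo_lt (e m') (q m) >] then q m else e m' else q 0%N.
exists e; split.
  by elim=> [|m IH] /=; [case: (qP 0%N)|case: ifP => // _; case: (qP m.+1)].
have eq_ m : ~ wo_lt (e m) (q m).
  case: m => [|m] /=; first exact: wo_irr.
  by case: asboolP => // _; exact: wo_irr.
have eS m : ~ wo_lt (e m.+1) (e m).
  move=> /=; case: asboolP => [lt gt|_]; last exact: wo_irr.
  by apply: (@wo_irr (e m)); exact: wo_trans lt gt.
move=> u uv; exists (h u) => m.
have uq : u = q (h u) by have [_ h'] := qP (h u); exact: h'.
suff : (h u <= m)%N -> ~ wo_lt (e m) (q (h u)) by rewrite -uq.
elim: m => [|m IH]; first by rewrite leqn0 => /eqP <-; exact: eq_.
rewrite leq_eqVlt => /orP[/eqP <-|]; first exact: eq_.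
by rewrite ltnS => /IH qm; exact: wo_nlt_trans qm (eS m).
Qed.

End WellOrders.

Lemma countable_wo_succ (A : wellOrder) : countable [set: A] ->
  exists h : wo_succ A -> nat, injective h.
Proof.
move=> /countable_injP[h hinj].
exists (fun u : option A => if u is Some a then (h a).+1 else 0%N).
by move=> [a|] [b|] //= [] /hinj ->//; rewrite inE.
Qed.

(** * The tree of relations and their survival under closures *)

Section RowTree.
Context {R : realType} {k : scalar_kind}.
Local Notation K := (scalars R k).
Context (X : completeNormedModType K).

Context (s : nat -> nat -> X) (y : nat -> nat -> dual X) (C : nat -> R) (d : nat -> X).
Hypothesis s2 : forall i m, rn (s i m) <= 2.
Hypothesis s0 : forall i m, (m < i)%N -> s i m = 0.
Hypothesis yC : forall i m, (i <= m)%N -> rn (y i m) <= C i.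
Hypothesis yd : forall i m l, (i <= m)%N -> (l < m)%N -> y i m (d l) = 0.
Hypothesis ys0 : forall i m l j, (i <= m)%N -> (l < m)%N -> y i m (s j l) = 0.
Hypothesis ys1 : forall i m l j, (i <= m)%N -> (m <= l)%N ->
  y i m (s j l) = (i == j)%:R.
Hypothesis d_dense : dense_seq d.

Context (B : wellOrder) (e : B -> nat -> B) (top : B).
Definition nonminimal (v : B) : Prop := exists u, wo_lt u v.
Hypothesis eP : forall v, if `[< nonminimal v >] then
    (forall m, wo_lt (e v m) v) /\
    forall u, wo_lt u v -> exists N, forall m, (N <= m)%N -> ~ wo_lt (e v m) u
  else forall m, e v m = v.

Let e_lt v m : nonminimal v -> wo_lt (e v m) v.
Proof. by move=> nv; have := eP v; rewrite asboolT// => -[]. Qed.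

(* The nodes of the tree are the finite sequences of natural numbers; the
   children of [q] are the [m :: q] and its value bounds theirs strictly. *)
Fixpoint value (p : seq nat) : B := if p is m :: q then e (value q) m else top.

Definition increment (p : seq nat) m : X :=
  s (pickle p) m - (if m is m'.+1 then s (pickle p) m' else 0).

Definition target (p : seq nat) : X :=
  if p is m :: q then toK (2 ^+ m) *: increment q m else 0.

Definition row_relation (p : seq nat) (f : dual X) : Prop :=
  @ecvg R k K^o (fun m => f (s (pickle p) m)) (f (target p)).

(** Nodes of minimal value are exempt: the least element of [B] pays for the passage from [M] to its
    first closure, during which no relation is lost. *)
Definition related : set (dual X) :=
  [set f | forall p, nonminimal (value p) -> row_relation p f].

Lemma target_linear_set (W : set X) p :
  linear_set W -> (forall i m, W (s i m)) -> W (target p).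
Proof.
move=> [W0 WP] Ws; case: p => [|m q] //=.
have Wi : W (increment q m).
  rewrite /increment -scaleN1r addrC; apply: WP => //.
  by case: m => [|m].
by have := WP (toK (2 ^+ m)) _ _ Wi W0; rewrite addr0.
Qed.

Lemma related0 : related 0.
Proof. by move=> p _ eps eps0; exists 0%N => m _; rewrite subrr rn0. Qed.

Lemma relatedZ a f : related f -> related (a *: f).
Proof.
move=> fr p /fr fp eps eps0.
have a0 : 0 < rn (a : K^o) + 1 by have := rn_ge0 (a : K^o); lra.
have [N hN] := fp _ (divr_gt0 eps0 a0).
exists N => m /hN; rewrite !dual_scaleE -mulrBr rnM ltr_pdivlMr// => h.
by have := rn_ge0 (f (s (pickle p) m) - f (target p)); lra.
Qed.

(** The index [N] is uniform in the row. For such [f] each relation is one scalar equation, which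
    can be repaired exactly. *)
Definition eventually_constant N (f : dual X) : Prop :=
  forall m i, (N <= m)%N -> f (s i m) = f (s i N).

Let row_relation_constant N f p : eventually_constant N f ->
  row_relation p f <-> f (s (pickle p) N) = f (target p).
Proof.
move=> fN; have cv : ecvg (fun m => f (s (pickle p) m)) (f (s (pickle p) N)).
  by move=> eps eps0; exists N => m Nm; rewrite fN// subrr rn0.
by split=> [/ecvg_uniq-/(_ _ cv)->//|fp]; rewrite /row_relation -fp.
Qed.

(** A row of code above [N] is zero up to index [N], so [f] has limit [0] along it. The target of
    [m :: q] is killed as well when [m > N], by constancy of [f], or when the code of [q] exceeds
    [N]. Finitely many nodes remain. *)
Let finitely_many_failures N f : eventually_constant N f ->
  exists P : seq (seq nat), forall p, p \notin P -> row_relation p f.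
Proof.
move=> fN; pose P0 : seq (seq nat) := pmap unpickle (iota 0 N.+1).
have P0P p : p \notin P0 -> (N < pickle p)%N.
  move=> pP; rewrite ltnNge; apply/negP => pN; case/negP: pP.
  rewrite mem_pmap; apply/mapP; exists (pickle p); last by rewrite pickleK.
  by rewrite mem_iota.
exists (P0 ++ [seq m :: q | m <- iota 0 N.+1, q <- P0]) => p.
rewrite mem_cat negb_or => /andP[/P0P Np pP].
apply/(row_relation_constant p fN); rewrite s0// linear0.
case: p pP {Np} => [|m q] pP /=; first by rewrite linear0.
suff -> : f (toK (2 ^+ m) *: increment q m) = 0 by [].
have [mN|Nm] := leqP m N.
  have Nq : (N < pickle q)%N.
    apply: P0P; apply/negP => qP; case/negP: pP.
    by apply: (allpairs_f (fun m q => m :: q)); rewrite ?mem_iota.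
  have sq l : (l <= N)%N -> s (pickle q) l = 0.
    by move=> lN; apply: s0; exact: leq_ltn_trans Nq.
  rewrite /increment sq//; case: m mN {pP} => [|m] mN; last rewrite sq ?(ltnW mN)//.
    by rewrite subrr scaler0 linear0.
  by rewrite subrr scaler0 linear0.
case: m Nm {pP} => [//|m] Nm.
rewrite linearZ linearB /= (fN m.+1)// ?(ltnW Nm)// (fN m)// subrr.
by rewrite mulr0.
Qed.

Definition correction (P : seq (seq nat)) (c : seq nat -> K) m : dual X :=
  \sum_(p <- P) c p *: y (pickle p) m.

Section Correction.
Context (P : seq (seq nat)).

Let correctionE c m x : correction P c m x = \sum_(p <- P) c p * y (pickle p) m x.
Proof.
rewrite /correction; elim/big_rec2: _ => // p a h _ <-.
by rewrite dual_addE dual_scaleE.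
Qed.

(** The corrections are bounded because [P] is finite, and the [n]-th one vanishes at [d l] for all
    [l < n]. *)
Lemma correction_null (c : nat -> seq nat -> K) (mm : nat -> nat) D :
  (forall n p, p \in P -> rn (c n p : K^o) <= D) ->
  (forall n, (n <= mm n)%N) ->
  (forall n (p : seq nat), p \in P -> (pickle p <= mm n)%N) ->
  weak_star_cvg (fun n => correction P (c n) (mm n)) 0.
Proof.
move=> cD mmn mmP.
apply: (weak_star_cvg_dense (C := \sum_(p <- P) D * C (pickle p)) d_dense) => [n|i].
  rewrite /correction big_seq [leRHS]big_seq.
  apply: (le_trans (rn_sum _ _ _)); apply: ler_sum => p pP.
  by rewrite rnZ ler_pM ?rn_ge0 ?cD ?yC ?mmP.
move=> eps eps0; exists i.+1 => n ni.
rewrite correctionE big_seq big1 => [|p pP]; last first.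
  by rewrite yd ?mulr0 ?mmP// (leq_trans ni).
by rewrite subrr rn0.
Qed.

Context (c : seq nat -> K) (m : nat).
Hypothesis P_uniq : uniq P.
Hypothesis Pm : forall p : seq nat, p \in P -> (pickle p <= m)%N.

Let correction_before q l : (l < m)%N -> correction P c m (s q l) = 0.
Proof.
move=> lm; rewrite correctionE big_seq big1// => p pP.
by rewrite ys0 ?Pm// mulr0.
Qed.

Let correction_after (q : seq nat) l : (m <= l)%N ->
  correction P c m (s (pickle q) l) = if q \in P then c q else 0.
Proof.
move=> ml; rewrite correctionE; have [qP|qP] := boolP (q \in P).
  rewrite (bigD1_seq q)//= ys1 ?Pm// eqxx mulr1 big_seq_cond big1 ?addr0//.
  move=> p /andP[pP pq]; rewrite ys1 ?Pm// (_ : (_ == _) = false) ?mulr0//.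
  by apply: contraNF pq => /eqP/(pcan_inj pickleK)/eqP.
rewrite big_seq big1// => p pP; rewrite ys1 ?Pm// (_ : (_ == _) = false) ?mulr0//.
by apply: contraNF qP => /eqP/(pcan_inj pickleK) <-.
Qed.

Let correction_constant : eventually_constant m (correction P c m).
Proof.
move=> l i ml; rewrite !correctionE; apply: eq_big_seq => p pP.
by rewrite !ys1 ?Pm.
Qed.

(** Along each row the correction is [0] before index [m] and constant from [m] on, so it sees only
    the [m]-th increments of the rows in [P]. *)
Let correction_increment (q : seq nat) l : (l != m) || (q \notin P) ->
  correction P c m (increment q l) = 0.
Proof.
rewrite /increment linearB /=; have [ml|ltm|mE] := ltngtP m l; rewrite ?eqxx /=.
- case: l ml => // l ml _.
  by rewrite (correction_after q ml) (correction_after q (ltnW ml)) subrr.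
- case: l ltm => [|l] lm _; first by rewrite correction_before// linear0 subr0.
  by rewrite (correction_before _ lm) (correction_before _ (ltnW lm)) subrr.
- move=> qP; have ml : (m <= l)%N by rewrite mE.
  rewrite (correction_after q ml) (negbTE qP) sub0r.
  case: l mE {ml} => [|l] mE; first by rewrite linear0 oppr0.
  by rewrite correction_before ?oppr0// mE.
Qed.

(** The coefficient [c p] is the defect of the relation at [p], and the correction adds it to the
    limit along row [p]. The only targets that can move are those of [m :: q] with [q] in [P], and
    such nodes are not in [P], all heads there being below [m]. *)
Lemma corrected N f : eventually_constant N f -> (N < m)%N ->
  (forall n q, n :: q \in P -> (n < m)%N) ->
  (forall p, c p = f (target p) - f (s (pickle p) N)) ->
  [/\ eventually_constant m (f + correction P c m),
      forall p : seq nat, p \in P -> row_relation p (f + correction P c m)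
    & forall p : seq nat, p \notin P -> row_relation p f ->
        (forall q, p = m :: q -> q \notin P) ->
        row_relation p (f + correction P c m)].
Proof.
move=> fN Nm Phead cE.
have gm : eventually_constant m (f + correction P c m).
  move=> l i ml; rewrite !dual_addE correction_constant// (fN l)// ?(fN m)//.
    exact: ltnW.
  by rewrite (leq_trans _ ml)// ltnW.
have target0 p : (forall q, p = m :: q -> q \notin P) -> correction P c m (target p) = 0.
  case: p => [|n q] pq; first by rewrite /= linear0.
  have -> : correction P c m (target (n :: q)) =
      toK (2 ^+ n) * correction P c m (increment q n) by rewrite /= linearZ.
  rewrite correction_increment ?mulr0//.
  by have [nm|//] := eqVneq n m; rewrite pq// nm.
split=> // p pP => [|fp pq]; apply/(row_relation_constant _ gm); rewrite !dual_addE.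
  rewrite correction_after// pP cE target0 => [|q pq]; last first.
    by move: pP; rewrite pq => /Phead; rewrite ltnn.
  by rewrite (fN m)// ?(ltnW Nm)// addr0 addrC subrK.
rewrite correction_after// (negbTE pP) target0// !addr0 (fN m) ?(ltnW Nm)//.
exact/(row_relation_constant _ fN).
Qed.

End Correction.
Section Closures.
Context (M : set (dual X)).
Hypothesis M1 : forall f, weak_star_limits M f -> related f.

(* The relations at the children [m :: p] bound the increments of row [p] by a
   multiple of [2^-m], so that the limits along the row and in [n] commute. *)
Let row_relation_limit p (N : nat) (f : dual X) (u : nat -> dual X) (c : R) :
  0 <= c -> (forall n, rn (u n) <= c) -> weak_star_cvg u f ->
  (forall n, row_relation p (u n)) ->
  (forall n m, (N <= m)%N -> row_relation (m :: p) (u n)) ->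
  row_relation p f.
Proof.
move=> c0 uc uf up ucp.
have small n m : (N <= m)%N -> rn (u n (increment p m)) <= 2 * c * 2^-1 ^+ m.
  move=> Nm; rewrite exprVn ler_pdivlMr ?exprn_gt0//.
  have -> : rn (u n (increment p m)) * 2 ^+ m = rn (u n (target (m :: p))).
    by rewrite /= linearZ /= rnM rn_toK_ge0 ?exprn_ge0// mulrC.
  apply: (ecvg_le (ucp n m Nm)); exists 0%N => l _.
  apply: (le_trans (rn_dual_apply_le _ (uc n))).
  by rewrite [2 * c]mulrC ler_wpM2l.
have step n m : (N <= m)%N ->
    rn (u n (target p) - u n (s (pickle p) m)) <= 2 * c * 2^-1 ^+ m.
  move=> Nm.
  pose t i : K^o := u n (s (pickle p) (i + m)%N).
  have tS i : rn (t i.+1 - t i) <= 2 * c * 2^-1 ^+ m * (1 - 2^-1) * 2^-1 ^+ i.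
    rewrite /t -linearB addSn -[s _ _ - _]/(increment p (i + m).+1).
    apply: (le_trans (small _ _ _)); first by rewrite leqW// (leq_trans Nm)// leq_addl.
    rewrite exprS exprD le_eqVlt; apply/orP; left; apply/eqP.
    have -> : 1 - 2^-1 = 2^-1 :> R by lra.
    by ring.
  have tb i : rn (t i - t 0%N) <= 2 * c * 2^-1 ^+ m.
    have := @geometric_dist R k K^o t (2 * c * 2^-1 ^+ m) (2^-1).
    move=> /(_ _ _ tS i 0%N); rewrite mulr1; apply => //.
    by rewrite !mulr_ge0// exprn_ge0.
  apply: (ecvg_le (ecvg_subr (u n (s (pickle p) m)) (up n))).
  exists m => i mi; have := tb (i - m)%N.
  by rewrite /t add0n subnK.
move=> eps eps0; have [N' hN'] := half_pow_small (2 * c) eps0.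
exists (maxn N N') => m; rewrite geq_max => /andP[Nm /hN']; apply: le_lt_trans.
rewrite rnB -linearB.
apply: (ecvg_le ((weak_star_cvgP _ _).1 uf _)).
by exists 0%N => n _; rewrite linearB; exact: step.
Qed.

(** A limit over the closure at [u] keeps the relation at [p] if [u] is below the value of [p]: by
    cofinality almost all children of [p] have value at least [u], so their relations hold by
    induction and [row_relation_limit] applies. For minimal [u] that closure is [M], and [M1] gives
    every relation. *)
Lemma closure_below_relation (v : B) f : closure_below M v f ->
  forall p, nonminimal (value p) -> ~ wo_lt (value p) v -> row_relation p f.
Proof.
elim/(well_founded_ind (@wo_wf B)): v f => v IH f.
rewrite closure_belowE => -[[_ Mf]|[u uv uf]] p np pv.
  by apply: M1 => //; exact: weak_star_limits_incl.
have [[t tu]|umin] := pselect (nonminimal u); last first.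
  apply: M1 => //; rewrite closure_below_min in uf => // t tu.
  by apply: umin; exists t.
have up : wo_lt u (value p) by exact: wo_lt_nlt pv.
have [N hN] : exists N, forall m, (N <= m)%N -> ~ wo_lt (value (m :: p)) u.
  by have := eP (value p); rewrite asboolT// => -[_]; exact.
have [w [wM wf]] := uf.
have [c c0 wc] := weak_star_bounded wf.
apply: (row_relation_limit (N := N) c0 wc wf) => [n|n m Nm].
  by apply: (IH u uv _ (wM n)) => // pu; apply: (wo_irr (v := u)); exact: wo_trans up pu.
apply: (IH u uv _ (wM n)); last exact: hN.
by exists t; exact: wo_lt_nlt tu (hN m Nm).
Qed.

Hypothesis related_limits :
  weak_star_limits related `<=` weak_star_limits (weak_star_limits M).

Let finite_except (w : B) (f : dual X) : Prop :=
  (exists N, eventually_constant N f) /\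
  forall p, nonminimal (value p) -> ~ wo_lt (value p) w -> row_relation p f.

(** Each [F n] violates finitely many relations, at nodes of value below [w]. A single nonminimal
    [u] below [w] bounds these values, even for limit [w], and the induction hypothesis at [u] puts
    [F n] into the closure at [w]. If nothing nonminimal lies below [w], every [F n] is in [related]
    and [related_limits] concludes. *)
Let closure_step w (F : nat -> dual X) f : nonminimal w ->
  (forall u, wo_lt u w -> nonminimal u -> forall f, (exists N, eventually_constant N f) ->
     (forall p, nonminimal (value p) -> wo_lt u (value p) -> row_relation p f) ->
     weak_star_limits (closure_below M u) f) ->
  weak_star_cvg F f -> (forall n, finite_except w (F n)) ->
  weak_star_limits (closure_below M w) f.
Proof.
move=> [t0 t0w] IH Ff Fw.
have [[u0 u0w u0n]|no] := pselect (exists2 u0, wo_lt u0 w & nonminimal u0); last first.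
  apply: (weak_star_limits_mono (limits_sub_closure_below t0w)).
  apply: related_limits; exists F; split => // n p np.
  by apply: (Fw n).2 => // pw; apply: no; exists (value p).
exists F; split => // n; have [[N FN] Fp] := Fw n.
have [P PP] := finitely_many_failures FN.
pose vs := [seq value p | p <- P & `[< wo_lt (value p) w >]].
have vsw v : List.In v vs -> wo_lt v w.
  rewrite /vs; elim: (P) => //= p P' IHP; case: asboolP => //= pw.
  by case=> [<-//|]; exact: IHP.
have invs (p : seq nat) : p \in P -> wo_lt (value p) w -> List.In (value p) vs.
  rewrite /vs; elim: (P) => //= q P' IHP; rewrite inE => /orP[/eqP ->|pP] pw.
    by rewrite asboolT//=; left.
  by case: asboolP => /= _; [right|]; exact: IHP.
have [u [uw uu0 uvs]] := wo_seq_max u0w vsw.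
have un : nonminimal u.
  by have [t tu0] := u0n; exists t; exact: wo_lt_nlt uu0.
apply: (closure_below_limits uw); apply: (IH u uw un); first by exists N.
move=> p np up; have [pw|pw] := pselect (wo_lt (value p) w); last exact: Fp.
have [pP|pP] := boolP (p \in P); last exact: PP.
by case: (uvs _ (invs _ pP pw)).
Qed.

Let large_index (P : seq (seq nat)) (N : nat) : exists m0, (N < m0)%N /\
  forall m, (m0 <= m)%N -> (forall p : seq nat, p \in P -> (pickle p <= m)%N) /\
    (forall n q, n :: q \in P -> (n < m)%N).
Proof.
elim: P => [|p P [m0 [Nm0 IH]]]; first by exists N.+1.
exists (maxn m0 (maxn (pickle p) (head 0%N p).+1)); split.
  by rewrite (leq_trans Nm0)// leq_maxl.
move=> m; rewrite !geq_max => /and3P[/IH[h1 h2] pm hm]; split.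
  by move=> q; rewrite inE => /orP[/eqP ->//|]; exact: h1.
move=> n q; rewrite inE => /orP[/eqP qp|]; last exact: h2.
by rewrite -qp in hm.
Qed.

Let weak_star_cvgD (u v : nat -> dual X) f g :
  weak_star_cvg u f -> weak_star_cvg v g -> weak_star_cvg (fun n => u n + v n) (f + g).
Proof. by move=> uf vg x; apply: cvgD; [exact: uf|exact: vg]. Qed.

(* Adding a multiple of [y (pickle q) m] repairs the relation at [q] and can
   only spoil the one at the child [m :: q], whose value is smaller; the
   correction tends to [0] as [m] grows. *)
Lemma finite_in_closure u : nonminimal u ->
  forall f, (exists N, eventually_constant N f) ->
  (forall p, nonminimal (value p) -> wo_lt u (value p) -> row_relation p f) ->
  weak_star_limits (closure_below M u) f.
Proof.
elim/(well_founded_ind (@wo_wf B)): u => w IH nw f [N fN] fp.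
have [P0 P0P] := finitely_many_failures fN.
pose P := undup [seq p <- P0 | `[< nonminimal (value p) /\ ~ row_relation p f >]].
have PP (p : seq nat) : p \in P -> nonminimal (value p) /\ ~ wo_lt w (value p).
  rewrite mem_undup mem_filter => /andP[/asboolP[np pf] _]; split => //.
  by move=> /(fp p np).
have PN (p : seq nat) : nonminimal (value p) -> p \notin P -> row_relation p f.
  move=> np; rewrite mem_undup mem_filter negb_and => /orP[/asboolPn h|/P0P//].
  by apply: contrapT => pf; apply: h.
have [m0 [Nm0 m0P]] := large_index P N.
pose c p : K := f (target p) - f (s (pickle p) N).
apply: (@closure_step w (fun n => f + correction P c (m0 + n)%N) f) => //.
  rewrite -[X in weak_star_cvg _ X]addr0; apply: weak_star_cvgD.
    by move=> x; exact: cvg_cst.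
  apply: (@correction_null P (fun=> c) (fun n => (m0 + n)%N)
    (\sum_(p <- P) rn (c p : K^o))).
  - move=> _ p pP; rewrite (bigD1_seq p) ?undup_uniq//= lerDl.
    by apply: sumr_ge0 => q _; exact: rn_ge0.
  - by move=> n; exact: leq_addl.
  - by move=> n p pP; exact: (m0P _ (leq_addr n m0)).1.
move=> n; have [h1 h2] := m0P _ (leq_addr n m0).
have [|g1 g2 g3] := @corrected P c (m0 + n)%N (undup_uniq _) h1 N f fN _ h2 (fun=> erefl).
  by rewrite (leq_trans Nm0)// leq_addr.
split; first by exists (m0 + n)%N.
move=> p np pw; have [pP|pP] := boolP (p \in P); first exact: g2.
apply: g3 => // [|q pq]; first exact: PN.
apply/negP => /PP[nq qw]; apply: pw; rewrite pq /=.
by apply: wo_lt_nlt qw; exact: e_lt.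
Qed.

Hypothesis top_max : forall v, ~ wo_lt top v.
Hypothesis top_nonminimal : nonminimal top.

(** Multiples of the [g l] approximate [f] and are eventually constant on the rows. As only the root
    has value [top], repairing the root relation is enough for [closure_step]. *)
Lemma closure_below_top_all (g : nat -> dual X) :
  (forall l m i, (l <= m)%N -> g l (s i m) = g l (s i l)) ->
  (forall l, rn (g l) <= 1) ->
  (forall f : dual X, rn f <= 1 -> forall n, exists l, forall i, (i < n)%N ->
     rn (g l (d i) - f (d i) : K^o) <= n.+1%:R^-1) ->
  weak_star_limits (closure_below M top) = setT.
Proof.
move=> gs g1 gdense; apply/seteqP; split=> // f _.
have r0 : 0 < rn f + 1 by have := rn_ge0 f; lra.
pose r : K := toK (rn f + 1).
have rr : rn (r : K^o) = rn f + 1 by rewrite rn_toK_ge0 ?ltW.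
have [l lP] : {l : nat -> nat & forall n i, (i < n)%N ->
    rn (g (l n) (d i) - (toK (rn f + 1)^-1 *: f : dual X) (d i) : K^o) <= n.+1%:R^-1}.
  apply: (@choice _ _ (fun n l => forall i, (i < n)%N ->
    rn (g l (d i) - (toK (rn f + 1)^-1 *: f : dual X) (d i) : K^o) <= n.+1%:R^-1)).
  move=> n; apply: gdense; rewrite rnZ rn_toK_ge0 ?invr_ge0 ?(ltW r0)//.
  by rewrite mulrC ler_pdivrMr// mul1r lerDl.
pose h n : dual X := r *: g (l n).
have h_bound n : rn (h n) <= rn f + 1.
  by rewrite rnZ rr ler_piMr ?(ltW r0).
have hf : weak_star_cvg h f.
  apply: (weak_star_cvg_dense d_dense h_bound) => i eps eps0.
  have [N hN] := inv_nat_small (divr_gt0 eps0 r0).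
  exists (maxn N i.+1) => n; rewrite geq_max => /andP[/hN hn ni].
  have -> : h n (d i) - f (d i) =
      r * (g (l n) (d i) - (toK (rn f + 1)^-1 *: f : dual X) (d i)).
    by rewrite dual_scaleE mulrBr mulrA -toKM divff ?gt_eqF// toK1 mul1r.
  rewrite rnM rr; apply: (@le_lt_trans _ _ ((rn f + 1) * n.+1%:R^-1)).
    by rewrite ler_wpM2l ?(ltW r0)//; exact: lP.
  by rewrite mulrC -ltr_pdivlMr.
have hs n : eventually_constant (l n) (h n).
  by move=> m i lm; rewrite !dual_scaleE gs.
pose P : seq (seq nat) := [:: [::]].
have [mm mmP] : {mm : nat -> nat & forall n, [/\ (n <= mm n)%N, (l n < mm n)%N,
    forall p : seq nat, p \in P -> (pickle p <= mm n)%N &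
    forall n' q, n' :: q \in P -> (n' < mm n)%N]}.
  apply: (@choice _ _ (fun n m => [/\ (n <= m)%N, (l n < m)%N,
    forall p : seq nat, p \in P -> (pickle p <= m)%N &
    forall n' q, n' :: q \in P -> (n' < m)%N])) => n.
  have [m0 [lm m0P]] := large_index P (l n).
  exists (m0 + n)%N; have [h1 h2] := m0P _ (leq_addr n m0); split => //.
    exact: leq_addl.
  by rewrite (leq_trans lm)// leq_addr.
pose c n p : K := h n (target p) - h n (s (pickle p) (l n)).
apply: (@closure_step top (fun n => h n + correction P (c n) (mm n)) f) => //.
- by move=> u _; exact: finite_in_closure.
- rewrite -[X in weak_star_cvg _ X]addr0; apply: weak_star_cvgD => //.
  apply: (@correction_null P c mm (2 * (rn f + 1))) => [n p|n|n].
  (* The root has target [0], so its defect for [h n] is bounded uniformly in [n] by the bound [2]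
     on the rows, although the repairing index varies with [n]. *)
  + rewrite inE => /eqP ->; rewrite /c /= linear0 sub0r rnN.
    have := rn_dual_apply_le (s (pickle ([::] : seq nat)) (l n)) (h_bound n).
    have := ler_wpM2l (ltW r0) (s2 (pickle ([::] : seq nat)) (l n)).
    by rewrite [2 * _]mulrC => h1 h2; exact: le_trans h1.
  + by case: (mmP n).
  + by case: (mmP n).
- move=> n; have [m1 m2 m3 m4] := mmP n.
  have [g2 g3 _] := @corrected P (c n) (mm n) isT m3 (l n) (h n) (hs n) m2 m4 (fun=> erefl).
  split; first by exists (mm n).
  move=> p np pt; have pE : p = [::]; last by rewrite pE; apply: g3; rewrite inE.
  case: p np pt => // m q np pt; exfalso; move: np pt => /=.
  have [nq|nq] := pselect (nonminimal (value q)).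
    move=> _; apply; have := e_lt m nq => h1.
    by apply: wo_lt_nlt h1 (@top_max _).
  by have := eP (value q); rewrite asboolF// => ->.
Qed.

(** The root relation survives in the closure at [top], but [y i i] has limit [1] instead of [0]
    along the root row. *)
Lemma closure_below_top_proper : closure_below M top <> setT.
Proof.
move=> MT; pose i := pickle ([::] : seq nat).
have : closure_below M top (y i i) by rewrite MT.
move=> /closure_below_relation/(_ [::] top_nonminimal (@wo_irr _ _))/(_ 1 ltr01).
move=> [N /(_ _ (leq_maxl N i))]; rewrite -/i /= linear0 subr0.
by rewrite ys1 ?leq_maxr// eqxx rn1 ltxx.
Qed.

End Closures.
End RowTree.

Section TransfiniteClosure.
Context {R : realType} {k : scalar_kind}.
Local Notation K := (scalars R k).
Context (X : completeNormedModType K) (Y : submodClosed (dual X)).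

(* The estimate of [T y] on [Y^T] is uniform on bounded sets, so that relations
   satisfied by all the [g l] pass to the weak* limits. *)
Lemma limits_related (T : {linear subspace_type Y -> dual X}) (g : nat -> dual X)
    (s : nat -> nat -> X) (B : wellOrder) (e : B -> nat -> B) (top : B) :
  (forall i m (f : dual X), f \in Y -> f (s i m) = 0) ->
  (forall i m, rn (s i m) <= 2) ->
  (forall y, rn y <= 2 * rn (T y)) ->
  (forall l, related s e top (g l)) ->
  (forall z, (forall y : dual X, y \in Y -> y z = 0) -> forall y n,
     rn ((T y : dual X) z) <= rn y * (\sum_(l < n) rn (g l z) + 2^-1 ^+ n * rn z)) ->
  weak_star_limits (range T) `<=` related s e top.
Proof.
move=> sY s2 Tlow gr Tz f [u [uT uf]] p np eps eps0.
have [C C0 uC] := weak_star_bounded uf.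
pose W := [set z : X | forall y : dual X, y \in Y -> y z = 0].
have Wl : linear_set W.
  split=> [y _|a u' v u'0 v0 y yY]; first exact: linear0.
  by rewrite linearP /= u'0// v0// mulr0 addr0.
have Ws i m : W (s i m) by move=> y; exact: sY.
have Wt : W (target s p) by exact: target_linear_set.
pose z m := s (pickle p) m - target s p.
have Wz m : W (z m) by move=> y yY; rewrite linearB /= Ws// Wt// subrr.
pose D := 2 + rn (target s p).
have zD m : rn (z m) <= D.
  by apply: (le_trans (rnD _ _)); rewrite rnN lerD2r.
have bound m n : rn (f (z m)) <= 2 * C * (\sum_(l < n) rn (g l (z m)) + D * 2^-1 ^+ n).
  apply: (ecvg_le ((weak_star_cvgP _ _).1 uf (z m))).
  exists 0%N => j _; have [y _ yu] := uT j; rewrite -yu.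
  apply: (le_trans (Tz _ (Wz m) y n)); apply: ler_pM; rewrite ?rn_ge0//.
  - rewrite addr_ge0// ?mulr_ge0 ?exprn_ge0 ?rn_ge0//.
    by apply: sumr_ge0 => l _; exact: rn_ge0.
  - by apply: (le_trans (Tlow y)); rewrite yu ler_wpM2l.
  - by rewrite lerD2l mulrC ler_wpM2r// exprn_ge0.
(* First [n] makes the tail smaller than [eps / 2]; then the relations of the finitely many [g l]
   with [l < n] bound the partial sum by [eps / 2]. In the next constant [C + 1] and [n.+1] replace
   [C] and [n] to keep the denominator positive. *)
have [n hn] := half_pow_small (2 * C * D) (divr_gt0 eps0 (ltr0n R 2)).
have e40 : 0 < eps / (4 * (C + 1) * n.+1%:R).
  by rewrite divr_gt0// mulr_gt0// mulr_gt0//; lra.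
have fin (e0 : R) j : 0 < e0 -> exists N, forall m l, (N <= m)%N -> (l < j)%N ->
    rn (g l (z m)) < e0.
  move=> e00; elim: j => [|j [N IH]]; first by exists 0%N.
  have [N' hN'] := gr j p np _ e00.
  exists (maxn N N') => m l; rewrite geq_max => /andP[Nm N'm].
  rewrite ltnS leq_eqVlt => /orP[/eqP ->|]; last exact: IH.
  by rewrite linearB; exact: hN'.
have [N hN] := fin _ n e40.
exists N => m Nm; rewrite -linearB; apply: (le_lt_trans (bound m n)).
have S : \sum_(l < n) rn (g l (z m)) <= n%:R * (eps / (4 * (C + 1) * n.+1%:R)).
  apply: (@le_trans _ _ (\sum_(l < n) eps / (4 * (C + 1) * n.+1%:R))).
    by apply: ler_sum => l _; apply: ltW; exact: hN.
  by rewrite sumr_const card_ord -[leLHS]mulr_natl.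
have {}S : 2 * C * \sum_(l < n) rn (g l (z m)) <= eps / 2.
  have n1 : n%:R / n.+1%:R <= 1 :> R by rewrite ler_pdivrMr// mul1r ler_nat.
  have C1 : C / (C + 1) <= 1 by rewrite ler_pdivrMr; lra.
  have -> : eps / 2 = 2 * (eps / 4) * 1 by lra.
  apply: (@le_trans _ _ (2 * (eps / 4) * (C / (C + 1) * (n%:R / n.+1%:R)))).
    apply: (le_trans (ler_wpM2l _ S)); first by rewrite mulr_ge0.
    rewrite le_eqVlt; apply/orP; left; apply/eqP; field.
    by rewrite gt_eqF//=; lra.
  rewrite ler_wpM2l//; first by lra.
  by rewrite mulr_ile1// divr_ge0//; lra.
by have := hn n (leqnn n); lra.
Qed.

(** The tree takes its values in [wo_succ A] with the root at the new greatest element, because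
    [closure_below] at that element is the closure of order [A]. Nonemptiness of [A] makes the root
    nonminimal, so that it carries a relation. *)
Lemma embedding_transfinite_closure (A : wellOrder) :
  separable_space X -> ~ finite_codim (range (Hmap Y)) ->
  ~ quasireflexive (subspace_type (preannihilator Y)) ->
  countable [set: A] -> [set: A] !=set0 ->
  exists T : {linear subspace_type Y -> dual X},
    [/\ isomorphic_embedding T,
        weak_star_closure (range T) A <> setT
      & weak_star_closure (range T) (wo_succ A) = setT].
Proof.
move=> Xsep HYcodim ZN Ac [a0 _].
have [d dd] := separable_dense_seq Xsep.
(* Two sequences of functionals occur. [g0] is dense in the whole unit ball and precedes the rows,
   which are built so that [g0 l] is constant along them from index [l] on; the later [g] is taken
   in [related], which depends on the rows. *)
have [|g0 [g01 g0dense]] := weak_star_dense_sequence d (S := [set f : dual X | rn f <= 1]).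
  by exists 0; rewrite /= rn0.
have [s [y [C [[sY s2 s0] sg0 yC yd ys]]]] := row_system ZN d g0.
have ys1 i m l j : (i <= m)%N -> (m <= l)%N -> y i m (s j l) = (i == j)%:R.
  by move=> im ml; exact: ys.
have [h hinj] := countable_wo_succ Ac.
have [e eP] := choice (cofinal_sequence hinj).
pose top : wo_succ A := None.
have [T [g [Temb Tlow gr Tz Tlim]]] := perturbed_embedding Xsep HYcodim
  (@related0 R k X s _ e top) (@relatedZ R k X s _ e top).
have M1 := limits_related sY s2 Tlow gr Tz.
have yd0 i m l : (i <= m)%N -> (l < m)%N -> y i m (d l) = 0.
  by move=> im lm; case: (yd i m l im lm).
have ys0 i m l j : (i <= m)%N -> (l < m)%N -> y i m (s j l) = 0.
  by move=> im lm; case: (yd i m l im lm).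
have sg1 l m i : (l <= m)%N -> g0 l (s i m) = g0 l (s i l).
  by move=> lm; exact: sg0.
have topmax v : ~ wo_lt top v by exact: id.
have topn : nonminimal top by exists (Some a0).
exists T; split => //.
  rewrite -closure_below_top.
  exact: (closure_below_top_proper s2 ys1 eP M1 topn).
rewrite weak_star_closure_succ -closure_below_top.
by rewrite (closure_below_top_all s2 s0 yC yd0 ys0 ys1 dd eP Tlim topmax topn
  sg1 g01 g0dense) setTU.
Qed.

End TransfiniteClosure.

Theorem theorem3 (R : realType) (k : scalar_kind)
    (X : completeNormedModType (scalars R k)) (Y : submodClosed (dual X))
    (X_separable : separable_space X)
    (HY_codim : ~ finite_codim (range (Hmap Y))) :
  [/\ (* (A) *)
      exists T : {linear subspace_type Y -> dual X},
        [/\ isomorphic_embedding T,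
            total_set (range T)
          & weak_star_closure (range T) (wo_fin 2) = setT],
      (* (B) *)
      ~ finite_dim (subspace_type (preannihilator Y)) ->
      exists T : {linear subspace_type Y -> dual X},
        [/\ isomorphic_embedding T,
            total_set (range T),
            weak_star_closure (range T) (wo_fin 1) <>
              weak_star_closure (range T) (wo_fin 2)
          & weak_star_closure (range T) (wo_fin 2) = setT]
    & (* (C) *)
      ~ quasireflexive (subspace_type (preannihilator Y)) ->
      forall A : wellOrder, countable [set: A] -> [set: A] !=set0 ->
      exists T : {linear subspace_type Y -> dual X},
        [/\ isomorphic_embedding T,
            weak_star_closure (range T) A <>
              weak_star_closure (range T) (wo_succ A)
          & weak_star_closure (range T) (wo_succ A) = setT]].
Proof.
have [T [Temb Ttotal T2 T1]] := embedding_second_closure X_separable HY_codim.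
split; first by exists T.
  by move=> Zinf; exists T; split => //; rewrite T2; exact: T1.
move=> ZN A Ac A0.
have [T' [T'emb T'A T'S]] :=
  embedding_transfinite_closure X_separable HY_codim ZN Ac A0.
by exists T'; split => //; rewrite T'S.
Qed.
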